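(* Assume that $X_1$ is such that $\mu_4<\infty$. Let the counting process $\{N(t);\,t\geq 0\}$ $\mathcal{D}$-average in time to the random variable $\Lambda$. Then $$\sqrt{t}\left(N(t)\,T_{N(t)}-\frac{\mu_2}{\mu_1^2}\right)\stackrel{\mathcal{D}}{\longrightarrow}\frac{\mathrm{N}(0,\sigma_*^2)}{\sqrt{\Lambda}}\quad\text{as } t\rightarrow\infty,$$ where the random variables $\mathrm{N}(0,\sigma_*^2)$ and $\Lambda$ are independent, $\mathrm{N}(0,\sigma_*^2)$ having the normal distribution with mean $0$ and variance $$\sigma_*^2:=\frac{\mu_4}{\mu_1^4}-\left(\frac{\mu_2}{\mu_1^2}\right)^2+4\left(\frac{\mu_2}{\mu_1^2}\right)^3-\frac{4\mu_2\mu_3}{\mu_1^5}.$$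
   Context: $\{X_1,X_2,\ldots\}$ is a sequence of i.i.d. positive random variables, and $\{N(t);\,t\geq 0\}$ is a counting process (nonnegative integer-valued, nondecreasing in $t$) independent of the $X_i$'s. For fixed $t\ge 0$, $$T_{N(t)}:=\frac{X_1^2+\cdots+X_{N(t)}^2}{(X_1+\cdots+X_{N(t)})^2}$$ if $N(t)\geq 1$, and $T_{N(t)}:=0$ otherwise. $\mu_\beta:=\mathbb{E}X_1^\beta\le\infty$ for $\beta>0$. The counting process $\mathcal{D}$-averages in time to the random variable $\Lambda$ if $N(t)/t\stackrel{\mathcal{D}}{\longrightarrow}\Lambda$ as $t\to\infty$, where $\mathbb{P}[\Lambda>0]=1$. $\stackrel{\mathcal{D}}{\longrightarrow}$ denotes convergence in distribution. *)

(* Defs.v *)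
From HB Require Import structures.
From mathcomp Require Import all_boot all_order all_algebra finmap.
From mathcomp Require Import all_classical all_reals all_analysis measurable_realfun.

Set Implicit Arguments.
Unset Strict Implicit.
Unset Printing Implicit Defensive.

Import Order.TTheory GRing.Theory Num.Theory.
Import numFieldNormedType.Exports.

Local Open Scope classical_set_scope.
Local Open Scope ring_scope.

Section independence.
Context d (T : measurableType d) (R : realType) (P : probability T R).

Definition independent_systems (F G : set (set T)) : Prop :=
  forall A B, F A -> G B -> P (A `&` B) = (P A * P B)%E.

Definition sigma_of_process d' (T' : measurableType d') (I : Type) (D : set I)
    (X : I -> T -> T') : set (set T) :=
  <<s \bigcup_(i in D) preimage_set_system setT (X i) measurable >>.

Definition independent_RVs d1 d2 (T1 : measurableType d1)
    (T2 : measurableType d2) (X : {RV P >-> T1}) (Y : {RV P >-> T2}) : Prop :=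
  independent_systems (preimage_set_system setT X measurable)
                      (preimage_set_system setT Y measurable).

Definition mutually_independent d' (T' : measurableType d') (I : choiceType)
    (X : I -> {RV P >-> T'}) : Prop :=
  forall (J : {fset I}) (A : I -> set T'), (forall i, measurable (A i)) ->
    P (\bigcap_(i in [set` J]) (X i @^-1` A i)) =
    (\prod_(i <- J) P (X i @^-1` A i))%E.

(* Laws are compared on measurable sets only: [distribution P X] is a function
   on all sets, whose values elsewhere are irrelevant. *)
Definition identically_distributed d' (T' : measurableType d') (I : Type)
    (X : I -> {RV P >-> T'}) : Prop :=
  forall i j (A : set T'), measurable A ->
    distribution P (X i) A = distribution P (X j) A.

End independence.
Arguments independent_systems {d T R} P F G.
Arguments independent_RVs {d T R} P {d1 d2 T1 T2} X Y.
Arguments mutually_independent {d T R} P {d' T' I} X.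
Arguments identically_distributed {d T R} P {d' T' I} X.

(* [normal_prob m 0] is the uniform law on [0, 1] in the library, whereas the
   normal law with variance 0 is the point mass at the mean.  The parameter v is
   the variance; [normal_prob] takes the standard deviation. *)
Definition normal_law (R : realType) (m v : R) (A : set R) : \bar R :=
  if v == 0 then \d_m A else normal_prob m (Num.sqrt v) A.

Definition has_normal_law d (T : measurableType d) (R : realType)
    (P : probability T R) (Z : {RV P >-> R}) (m v : R) : Prop :=
  forall A : set R, measurable A -> distribution P Z A = normal_law m v A.
Arguments has_normal_law {d T R} P Z m v.

Definition moment d (T : measurableType d) (R : realType)
    (P : probability T R) (X : {RV P >-> R}) (k : nat) : \bar R :=
  ('E_P[fun w => (X w ^+ k)%R])%E.
Arguments moment {d T R} P X k.

(* Convergence of distribution functions at the continuity points of the limit.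
   The limit variable may live on another probability space. *)
Definition cvg_in_distribution d d' (T : measurableType d)
    (T' : measurableType d') (R : realType) (P : probability T R)
    (P' : probability T' R) (X : R -> {RV P >-> R}) (Y : {RV P' >-> R}) : Prop :=
  forall x : R, {for x, continuous (cdf Y)} ->
    cdf (X t) x @[t --> +oo%R] --> cdf Y x.
Arguments cvg_in_distribution {d d' T T' R} P P' X Y.

Section random_variables.
Context d (T : measurableType d) (R : realType) (P : probability T R).

Let measurable_inv : measurable_fun [set: R] (@GRing.inv R).
Proof.
rewrite -(setvU [set 0 : R]); apply/measurable_funU.
- exact: measurableC.
- exact: measurable_set1.
split; last exact: measurable_fun_set1.
apply: open_continuous_measurable_fun.
  by apply: closed_openC; exact: closed_eq.
by move=> x /set_mem /= /eqP x0; exact: inv_continuous.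
Qed.

Let measurable_random_index (f : nat -> T -> R) (N : {RV P >-> nat}) :
  (forall n, measurable_fun setT (f n)) ->
  measurable_fun setT (fun w => f (N w) w).
Proof.
move=> mf _ A mA; rewrite setTI.
have -> : (fun w => f (N w) w) @^-1` A =
    \bigcup_n (N @^-1` [set n] `&` f n @^-1` A).
  apply/seteqP; split => [w Aw|w [n _ [/= <- //]]].
  by exists (N w).
apply: bigcup_measurable => n _; apply: measurableI;
  rewrite -[X in measurable X]setTI.
  exact: measurable_funPT.
exact: mf.
Qed.

Definition real_of_count (N : {RV P >-> nat}) : T -> R := fun w => (N w)%:R.

Let measurable_real_of_count (N : {RV P >-> nat}) :
  measurable_fun setT (real_of_count N).
Proof.
by apply: (measurable_random_index (f := fun n _ => n%:R)) => n;
  exact: measurable_cst.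
Qed.

HB.instance Definition _ (N : {RV P >-> nat}) :=
  isMeasurableFun.Build _ _ _ _ (real_of_count N) (measurable_real_of_count N).

(* The sequence is indexed from 0: its first n terms are X 0, ..., X n.-1. *)
Definition T_stat (X : nat -> {RV P >-> R}) (N : {RV P >-> nat}) : T -> R :=
  fun w => if (0 < N w)%N
    then (\sum_(i < N w) X i w ^+ 2) / (\sum_(i < N w) X i w) ^+ 2
    else 0.

Let measurable_T_stat (X : nat -> {RV P >-> R}) (N : {RV P >-> nat}) :
  measurable_fun setT (T_stat X N).
Proof.
apply: (measurable_random_index (f := fun n w => if (0 < n)%N
  then (\sum_(i < n) X i w ^+ 2) / (\sum_(i < n) X i w) ^+ 2 else 0)) => n.
case: (0 < n)%N; last exact: measurable_cst.
apply: measurable_funM.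
  by apply: measurable_sum => i; apply: measurable_funX.
apply: (measurableT_comp measurable_inv).
by apply: measurable_funX; apply: measurable_sum.
Qed.

HB.instance Definition _ (X : nat -> {RV P >-> R}) (N : {RV P >-> nat}) :=
  isMeasurableFun.Build _ _ _ _ (T_stat X N) (measurable_T_stat X N).

Definition inv_sqrt (L : {RV P >-> R}) : T -> R :=
  fun w => (Num.sqrt (L w))^-1.

Let measurable_inv_sqrt (L : {RV P >-> R}) : measurable_fun setT (inv_sqrt L).
Proof.
apply: (measurableT_comp measurable_inv); apply: measurableT_comp => //.
by apply: continuous_measurable_fun; exact: sqrt_continuous.
Qed.

HB.instance Definition _ (L : {RV P >-> R}) :=
  isMeasurableFun.Build _ _ _ _ (inv_sqrt L) (measurable_inv_sqrt L).

End random_variables.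

(* A process indexed by [0, +oo[ is represented by a family over R whose values
   at negative times are never used. *)
Definition counting_process d (T : measurableType d) (R : realType)
    (P : probability T R) (N : R -> {RV P >-> nat}) : Prop :=
  forall s t w, 0 <= s -> s <= t -> (N s w <= N t w)%N.
Arguments counting_process {d T R} P N.

Definition D_averages_in_time d d' (T : measurableType d)
    (T' : measurableType d') (R : realType) (P : probability T R)
    (P' : probability T' R) (N : R -> {RV P >-> nat})
    (L : {RV P' >-> R}) : Prop :=
  P' [set w | 0 < L w] = 1%E /\
  cvg_in_distribution P P' (fun t => real_of_count (N t) \* cst (t^-1)) L.
Arguments D_averages_in_time {d d' T T' R} P P' N L.

(* Main.v *)
(** Write [V_n = sqrt n (n T_n - m2/m1^2)], with [m_k] the moments of [X].  The
delta method turns [V_n] into [n^(-1/2)] times the sum of the centred i.i.d.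
variables [(X_i^2 - m2)/m1^2 - 2 m2 (X_i - m1)/m1^3], whose variance is the
announced one, so [V_n] is asymptotically normal by the central limit theorem.
The latter is proved by Stein's method: for a ramp [h] between two half-lines,
the solution of [s^2 g' - x g = h - E h(N(0, s^2))] has a derivative that tends
to 0 at infinity (Mills' ratio), hence is bounded and uniformly continuous, and
leaving out one summand at a time gives [E (s^2 g'(S_n) - S_n g(S_n)) -> 0].

For the random index, [sqrt t (N T_N - m2/m1^2) <= x] means
[V_N <= x sqrt (N/t)].  The values of [N/t] are cut into small cells [(a, b]]
whose endpoints are continuity points of [L].  On such a cell, [N] being
independent of the [X_i] and large, the probability of the event is squeezed
between [F(x sqrt a)] and [F(x sqrt b)] times the probability of the cell, [F]
being the limiting distribution function; so is the probability of
[Z <= x sqrt L], and the discrepancies add up to a small quantity. *)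

Require Import Defs.
From HB Require Import structures.
From mathcomp Require Import all_boot all_order all_algebra finmap.
From mathcomp Require Import all_classical all_reals all_analysis measurable_realfun.
From mathcomp Require Import ring lra.

Import Order.TTheory GRing.Theory Num.Theory.
Import numFieldNormedType.Exports.

Local Open Scope classical_set_scope.
Local Open Scope ring_scope.

(** * Independence *)

(** The summands of the central limit theorem are quadratic in [X], so a fourth moment of [X] gives
    them only a second moment. A Taylor bound with third moments is out of reach; the remainder is
    controlled by the uniform continuity of g' and dominated convergence.

    The hypotheses allow a zero limiting variance (constant [X], for instance). The limit is then a
    point mass, for which the Stein equation degenerates and the distribution function jumps at 0.
    Chebyshev's inequality replaces the normal approximation there, and the statements carry the
    alternative of a positive variance or a nonzero point.

    [N/t] and [L] may live on different spaces and are related only through their laws. Conditioning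
    on the value of [N] reduces everything to V_n at deterministic n, and the error allowed on a
    cell is proportional to the probability of that cell, so that the number of cells is
    immaterial. *)

Lemma independent_systems_sigmal d (T : measurableType d) (R : realType)
    (P : probability T R) (F G : set (set T)) :
  F `<=` measurable -> G `<=` measurable -> setI_closed F ->
  independent_systems P F G -> independent_systems P <<s F >> G.
Proof.
move=> mF mG FI FG A B FA GB.
have mB := mG _ GB.
have PB0 : 0 <= fine (P B) by rewrite fine_ge0.
(* For fixed [B], the maps A -> P(A and B) and A -> P(B) P(A) are finite measures. Uniqueness from a
   pi-system asks the system to cover the space, hence the adjoined [setT]. *)
pose F' := F `|` [set setT].
have F'A : <<s F' >> A by exact: (@sub_sigma_algebra2 _ _ F' F (@subsetUl _ _ _) _ FA).
pose m1 := mrestr P mB.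
pose m2 := mscale (NngNum PB0) P.
suff : P (A `&` B) = m2 A.
  move=> ->.
  change ((fine (P B))%:E * P A = P A * P B)%E.
  by rewrite fineK ?fin_num_measure// muleC.
apply: (@g_sigma_algebra_measure_unique _ _ _ F' _ (fun=> setT) _ _ m1 m2) => //.
- by move=> C [/mF//|->].
- by right.
- by rewrite bigcup_const.
- move=> C D [FC [FD|->]|-> [FD|->]]; rewrite ?setIT ?setTI.
  + by left; exact: FI.
  + by left.
  + by left.
  + by right.
- move=> C FC; change (P (C `&` B) = (fine (P B))%:E * P C)%E.
  rewrite fineK ?fin_num_measure// muleC.
  by case: FC => [FC|->]; [rewrite FG|rewrite setTI probability_setT mul1e].
- move=> _; change (P (setT `&` B) < +oo)%E.
  by rewrite (le_lt_trans (probability_le1 _ _)) ?ltry//; exact: measurableI.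
Qed.

Lemma integrable_distribution d (T : measurableType d) d1 (T1 : measurableType d1)
    (R : realType) (P : probability T R) (X : {RV P >-> T1}) (f : T1 -> \bar R) :
  measurable_fun setT f -> P.-integrable setT (f \o X) ->
  (distribution P X).-integrable setT f.
Proof.
by move=> mf iX; apply: integrable_pushforward => //; rewrite preimage_setT.
Qed.

Section expectation_of_product.
Context d (T : measurableType d) (R : realType) (P : probability T R).
Variables U V : T -> R.
Hypotheses (mU : measurable_fun setT U) (mV : measurable_fun setT V).
Hypothesis UV : forall A B, measurable A -> measurable B ->
  P (U @^-1` A `&` V @^-1` B) = (P (U @^-1` A) * P (V @^-1` B))%E.
Hypotheses (iU : P.-integrable setT (EFin \o U))
  (iV : P.-integrable setT (EFin \o V)).

HB.instance Definition _ := isMeasurableFun.Build _ _ _ _ U mU.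
HB.instance Definition _ := isMeasurableFun.Build _ _ _ _ V mV.
Let W : T -> R * R := fun w => (U w, V w).
Let mW : measurable_fun setT W. Proof. exact: measurable_fun_pair. Qed.
HB.instance Definition _ := isMeasurableFun.Build _ _ _ _ W mW.

(** Rectangles determine a measure on the plane. Independence thus becomes an equality of laws,
    after which Tonelli gives the integrability of the product and Fubini its expectation. *)
Let law_pair (A : set (R * R)) : measurable A ->
  (distribution P U \x distribution P V)%E A = distribution P W A.
Proof.
apply: product_measure_unique => A1 A2 mA1 mA2.
exact: UV.
Qed.

Let mprod : measurable_fun setT (fun z : R * R => (z.1 * z.2)%:E).
Proof. by apply/measurable_EFinP; exact: measurable_funM. Qed.

Let integrable_prod : (distribution P U \x distribution P V)%E.-integrable setT
  (fun z : R * R => (z.1 * z.2)%:E).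
Proof.
apply/integrable12ltyP => //=.
have norm_integrable (Y : {RV P >-> R}) : P.-integrable setT (EFin \o Y) ->
    (distribution P Y).-integrable setT (fun x : R => `|x|%:E).
  move=> iY; apply: integrable_distribution; last exact: integrable_norm iY.
  by apply/measurable_EFinP; exact: normr_measurable.
have iU' := norm_integrable _ iU; have iV' := norm_integrable _ iV.
under eq_integral => x _.
  under eq_integral => y _ do rewrite normrM EFinM.
  rewrite integralZl//.
  over.
rewrite /= -(fineK (integrable_fin_num _ iV'))//.
by rewrite integralZr//= -[X in (X * _)%E](fineK (integrable_fin_num _ iU'))// -EFinM ltry.
Qed.

Lemma integrable_mul_independent : P.-integrable setT (EFin \o (U \* V)).
Proof.
apply/integrableP; split; first by apply/measurable_EFinP; exact: measurable_funM.
have /integrableP[_] := integrable_prod.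
rewrite (eq_measure_integral (distribution P W)); last by move=> A mA _; exact: law_pair.
rewrite ge0_integral_distribution//=.
by apply/measurable_EFinP; apply: measurableT_comp => //; exact: measurable_funM.
Qed.

Lemma expectation_mul_independent :
  \int[P]_w (U w * V w) = (\int[P]_w U w) * (\int[P]_w V w).
Proof.
rewrite /Rintegral.
transitivity (fine (\int[distribution P W]_z (z.1 * z.2)%:E)).
  by rewrite integral_distribution//; exact: integrable_mul_independent.
rewrite (eq_measure_integral (distribution P U \x distribution P V)%E); last first.
  by move=> A mA _; apply/esym; exact: law_pair.
rewrite -integral12_prod_meas1//= /fubini_F/=.
have iV' : (distribution P V).-integrable setT EFin by exact: integrable_distribution.
have iU' : (distribution P U).-integrable setT EFin by exact: integrable_distribution.
under eq_integral => x _.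
  under eq_integral => y _ do rewrite EFinM.
  rewrite integralZl//.
  over.
rewrite -(fineK (integrable_fin_num _ iV'))// integralZr// fineM//; last exact: integrable_fin_num.
by rewrite !integral_distribution.
Qed.

End expectation_of_product.

Section leave_one_out_sum.
Context d (T : measurableType d) (R : realType) (P : probability T R).
Variable Y : nat -> {RV P >-> R}.
Hypothesis iY : mutually_independent P Y.
Variables (n i : nat).

Let J : {fset nat} := [fset j in iota 0 n | j != i]%fset.

(** A pi-system generating the sigma-algebra of the [Y j] with j < n and j != i. All cylinders have
    the full base [J], so they intersect coordinatewise; a free coordinate carries [setT]. *)
Let cylinder : set (set T) :=
  [set C | exists2 A : nat -> set R, (forall j, measurable (A j)) &
    C = \bigcap_(j in [set` J]) (Y j @^-1` A j)].

Let cylinderI : setI_closed cylinder.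
Proof.
move=> _ _ [A mA ->] [B mB ->]; exists (fun j => A j `&` B j).
  by move=> j; exact: measurableI.
apply/seteqP; split => [w [wA wB] j jJ|w wAB].
  by split; [exact: wA|exact: wB].
by split => j jJ; have [] := wAB _ jJ.
Qed.

Let measurable_cylinder : cylinder `<=` measurable.
Proof.
move=> _ [A mA ->]; apply: bigcap_measurableType => j _.
by rewrite -[X in measurable X]setTI; exact: measurable_funPT.
Qed.

Let independent_cylinder : independent_systems P cylinder
  (preimage_set_system setT (Y i) measurable).
Proof.
move=> _ _ [A mA ->] [B mB <-]; rewrite setTI.
(* With [B] placed at coordinate [i], the intersection is a single cylinder over [J] and [i], to
   which mutual independence applies. *)
pose A' j := if j == i then B else A j.
have mA' j : measurable (A' j) by rewrite /A'; case: ifP.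
have iJ : i \notin J by rewrite !inE /= eqxx andbF.
have A'E j : j \in J -> A' j = A j.
  by rewrite /A'; case: eqP => // ->; rewrite (negbTE iJ).
have -> : \bigcap_(j in [set` J]) (Y j @^-1` A j) `&` Y i @^-1` B =
    \bigcap_(j in [set` (i |` J)%fset]) (Y j @^-1` A' j).
  apply/seteqP; split => [w [wA wB] j /=|w wA].
    rewrite in_fset1U => /orP[/eqP ->|jJ]; first by rewrite /A' eqxx.
    by rewrite A'E//; exact: wA.
  split; first by move=> j jJ; rewrite /= -A'E//; apply: wA; rewrite /= in_fset1U jJ orbT.
  by have /= := wA i; rewrite /A' eqxx; apply; rewrite in_fset1U eqxx.
rewrite iY// big_fsetU1//= /A' eqxx muleC; congr *%E.
rewrite iY//; rewrite big_seq [RHS]big_seq; apply: eq_bigr => j jJ.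
by rewrite -/(A' j) A'E.
Qed.

Lemma independent_leave_one_out (A B : set R) :
  measurable A -> measurable B ->
  P ((fun w => \sum_(j < n | j != i :> nat) Y j w) @^-1` A `&` Y i @^-1` B) =
  (P ((fun w => (\sum_(j < n | j != i :> nat) Y j w)%R) @^-1` A) *
    P (Y i @^-1` B))%E.
Proof.
move=> mA mB; apply: (independent_systems_sigmal _ _ _ P _ _ measurable_cylinder _
  cylinderI independent_cylinder).
- by move=> _ [C mC <-]; exact: measurable_funPT.
- have mY (j : 'I_n) : j != i :> nat ->
      measurable_fun setT (Y j : g_sigma_algebraType cylinder -> R).
    move=> ji _ C mC; rewrite setTI; apply: sub_sigma_algebra.
    exists (fun k => if k == j :> nat then C else setT).
      by move=> k; case: ifP.
    apply/seteqP; split=> [w wC k _ /=|w /(_ (nat_of_ord j))].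
      by case: ifP => // /eqP ->.
    by rewrite /= eqxx; apply; rewrite !inE ji mem_iota add0n ltn_ord.
  (* Replacing the excluded terms by 0 turns the filtered sum into a full sum of functions that are
     all measurable for the generated sigma-algebra. *)
  pose f (j : nat) : g_sigma_algebraType cylinder -> R :=
    if (j < n)%N && (j != i) then Y j else cst 0.
  have mf : measurable_fun setT
      ((fun w => \sum_(j < n | j != i :> nat) Y j w) :
      g_sigma_algebraType cylinder -> R).
    rewrite [X in measurable_fun _ X](_ : _ = fun w => \sum_(j < n) f j w); last first.
      apply/funext => w; rewrite big_mkcond/=; apply: eq_bigr => j _.
      by rewrite /f ltn_ord/=; case: ifP.
    apply: measurable_sum => j; rewrite /f ltn_ord/=; case: ifPn => // ji; exact: mY.
  by have := mf measurableT _ mA; rewrite setTI.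
- by exists B => //; rewrite setTI.
Qed.

End leave_one_out_sum.

(** * The Stein equation of a centred normal law *)

Lemma mean_value (R : realType) (f df : R -> R) (x y : R) : x <= y ->
  (forall z, x <= z <= y -> is_derive z 1 f (df z)) ->
  exists2 c, x <= c <= y & f y - f x = df c * (y - x).
Proof.
move=> xy fd.
have [||c] := @MVT_segment R f df x y xy.
- by move=> z; rewrite in_itv/= => /andP[xz zy]; apply: fd; rewrite (ltW xz) ltW.
- apply: derivable_within_continuous => z; rewrite in_itv/= => zxy.
  by have := fd _ zxy => -[].
- by rewrite in_itv/=; exists c.
Qed.

Section gaussian.
Context {R : realType} (s : R).
Hypothesis s0 : 0 < s.
Local Notation mu := lebesgue_measure.
Local Notation phi := (normal_pdf 0 s).

Let sN0 : s != 0. Proof. by rewrite gt_eqF. Qed.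

Definition gaussian_cdf (s x : R) : R := fine (normal_prob 0 s `]-oo, x]).

Lemma normal_pdf_gt0 x : 0 < phi x.
Proof. by rewrite normal_pdfE// mulr_gt0 ?expR_gt0// normal_peak_gt0. Qed.

Lemma is_derive_normal_pdf (x : R) : is_derive x 1 phi (- (x / s ^+ 2) * phi x).
Proof.
rewrite normal_pdfE// /normal_fun.
have -> : (fun y => normal_peak s * expR (- (y - 0) ^+ 2 / (s ^+ 2 *+ 2))) =
  normal_peak s *: (expR \o ((- (s ^+ 2 *+ 2)^-1) *: (@id R ^+ 2))) :> (R -> R).
  apply/funext => y /=; rewrite !fctE /= subr0.
  by congr (_ * expR _); rewrite mulNr -mulrN mulrC.
apply: is_derive_eq; rewrite /= !fctE subr0 /GRing.scale /=.
have : s ^+ 2 != 0 by rewrite expf_neq0.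
move=> v0.
rewrite -mulr_natl.
have -> : - (2 * s ^+ 2)^-1 * x ^+ 2 = - x ^+ 2 / (2 * s ^+ 2) by rewrite mulNr mulrC mulNr.
by field.
Qed.

Lemma normal_pdf_even x : phi (- x) = phi x.
Proof. by rewrite normal_pdfE// /normal_fun !subr0 sqrrN. Qed.

Lemma integrable_mul_normal_pdf (h : R -> R) (D : set R) : measurable D ->
  continuous h -> (forall x, 0 <= h x <= 1) ->
  mu.-integrable D (EFin \o (fun t => h t * phi t)).
Proof.
move=> mD ch h01; apply: (integrableS measurableT) => //.
apply: le_integrable (integrable_normal_pdf 0 s) => //.
  apply/measurable_EFinP/measurable_funM; first exact: continuous_measurable_fun.
  exact: measurable_normal_pdf.
move=> x _ /=; have /andP[h0 h1] := h01 x.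
by rewrite lee_fin normrM (ger0_norm h0) ler_piMl.
Qed.

Lemma is_derive_integral_normal_pdf (h : R -> R) (x : R) :
  continuous h -> (forall x, 0 <= h x <= 1) ->
  is_derive x 1 (fun y => \int[mu]_(t in `]-oo, y]) (h t * phi t)) (h x * phi x).
Proof.
move=> ch h01.
have ci : {for x, continuous (fun t => h t * phi t)}.
  by apply: continuousM; [exact: ch|exact: continuous_normal_pdf].
(* The end [x + 1] only serves to make [x] an interior point. *)
have [] := @continuous_FTC1 R (fun t => h t * phi t) -oo%O x (x + 1) _ _ _ ci.
- by rewrite ltrDl.
- exact: integrable_mul_normal_pdf.
- exact: ltNyr.
move=> dF <-; rewrite derive1E; exact/derivableP.
Qed.

Lemma gaussian_cdfE x :
  gaussian_cdf s x = \int[mu]_(t in `]-oo, x]) (1 * phi t).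
Proof. by rewrite /gaussian_cdf; apply: eq_Rintegral => t _; rewrite mul1r. Qed.

Lemma is_derive_gaussian_cdf (x : R) : is_derive x 1 (gaussian_cdf s) (phi x).
Proof.
have := @is_derive_integral_normal_pdf (cst 1) x.
rewrite /= mul1r; under eq_fun do rewrite -gaussian_cdfE.
by apply=> [y|y]; [exact: cvg_cst|rewrite ler01 lexx].
Qed.

Lemma gaussian_cdf_lipschitz x y :
  `|gaussian_cdf s x - gaussian_cdf s y| <= normal_peak s * `|x - y|.
Proof.
wlog xy : x y / y <= x.
  move=> H; have [/H//|/ltW/H] := leP y x.
  by rewrite distrC (distrC y).
have [c _ ->] := mean_value _ _ _ _ _ xy (fun z _ => is_derive_gaussian_cdf z).
by rewrite normrM ler_wpM2r// ger0_norm ?normal_pdf_ge0// normal_pdf_ub.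
Qed.

(** Under [normal_prob 0 s] the identity is a random variable whose distribution function is
    [gaussian_cdf s]; the general limits at both infinities then apply. *)
Let idR : measurableTypeR R -> R := idfun.
HB.instance Definition _ :=
  @isMeasurableFun.Build _ _ _ _ idR (@measurable_id _ _ setT).

Let gaussian_cdf_idR : gaussian_cdf s = fine \o cdf (idR : {RV normal_prob 0 s >-> R}).
Proof. by []. Qed.

Lemma cvg_gaussian_cdfNy : gaussian_cdf s x @[x --> -oo] --> (0 : R).
Proof. by rewrite gaussian_cdf_idR; apply: fine_cvg; exact: cvg_cdfNy0. Qed.

Lemma cvg_gaussian_cdfy : gaussian_cdf s x @[x --> +oo] --> (1 : R).
Proof. by rewrite gaussian_cdf_idR; apply: fine_cvg; exact: cvg_cdfy1. Qed.

End gaussian.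

(** * Tails of the normal law: Mills' ratio *)

Section mills_ratio.
Context {R : realType} (s K : R) (phi A : R -> R).
Hypothesis s0 : 0 < s.
Hypotheses (phi0 : forall x, 0 < phi x) (phiK : forall x, phi x <= K).
Hypothesis dphi : forall x : R, is_derive x 1 phi (- (x / s ^+ 2) * phi x).
Hypothesis dA : forall x : R, is_derive x 1 A (phi x).
Hypothesis A0 : A x @[x --> -oo] --> (0 : R).

Let v0 : 0 < s ^+ 2. Proof. by rewrite exprn_gt0. Qed.

Let below (u e : R) : 0 < e -> exists2 y, y < u & `|A y| < e.
Proof.
move=> e0.
have : \forall y \near -oo, y < u /\ `|A y| < e.
  move/cvgr0Pnorm_lt : A0 => /(_ _ e0) Ae.
  near=> y; split; near: y => //; apply: nbhs_ninfty_lt; exact: num_real.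
move=> /filter_ex[y [yu Ay]]; by exists y.
Unshelve. all: by end_near. Qed.

(** [g1] and [g2] are the errors of the one- and two-term tail expansions -s^2 phi/x and -s^2 phi/x
    + s^4 phi/x^3 of [A]. Both vanish at -oo and are monotone on the negative axis, which determines
    their signs. [A] is abstract because it stands for Phi(y) at the left tail and for 1 - Phi(-y)
    at the right one. *)
Let g1 x := A x + s ^+ 2 * (phi x * x^-1).
Let g2 x := g1 x - s ^+ 4 * (phi x * (x^-1 * (x^-1 * x^-1))).

Let dV (x : R) : x < 0 -> is_derive x 1 (@GRing.inv R) (- x^-1 ^+ 2).
Proof.
move=> x0; have xN0 : x != 0 by rewrite lt_eqF.
by apply: is_derive_eq; [exact: (@is_deriveV _ id x 1 1)|rewrite scaler1 expr2 exprVn].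
Qed.

Let dg1 (x : R) : x < 0 -> is_derive x 1 g1 (- (s ^+ 2 * phi x * x^-1 ^+ 2)).
Proof.
move=> x0; have xN0 : x != 0 by rewrite lt_eqF.
have sN0 : s != 0 by rewrite gt_eqF.
have D := is_deriveD (dA x) (is_deriveZ (s ^+ 2) (is_deriveM (dphi x) (dV x x0))).
apply: (is_derive_eq D); rewrite /GRing.scale/=.
by field; rewrite xN0 sN0.
Qed.

Let dg2 (x : R) : x < 0 -> is_derive x 1 g2 (3 * s ^+ 4 * phi x * x^-1 ^+ 4).
Proof.
move=> x0; have xN0 : x != 0 by rewrite lt_eqF.
have sN0 : s != 0 by rewrite gt_eqF.
have dVx := dV x x0.
have D := is_deriveB (dg1 x x0)
  (is_deriveZ (s ^+ 4) (is_deriveM (dphi x) (is_deriveM dVx (is_deriveM dVx dVx)))).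
apply: (is_derive_eq D); rewrite /GRing.scale/=.
rewrite !fctE.
by field; rewrite xN0 sN0.
Qed.

Let g1_le0 x : x < 0 -> g1 x <= 0.
Proof.
move=> x0; apply/ler_addgt0Pr => e e0; rewrite add0r.
have [y yx Ay] := below x _ e0.
have dg z : y <= z <= x -> is_derive z 1 g1 (- (s ^+ 2 * phi z * z^-1 ^+ 2)).
  by move=> /andP[_ zx]; exact: dg1 (le_lt_trans zx x0).
have [k /andP[yk' kx] E] := mean_value R g1 _ y x (ltW yx) dg.
have : g1 x <= g1 y.
  rewrite -subr_le0 E mulr_le0_ge0 ?subr_ge0 ?(ltW yx)// oppr_le0.
  by rewrite mulr_ge0 ?exprn_even_ge0// mulr_ge0 ?(ltW v0) ?ltW.
move=> /le_trans; apply; rewrite /g1.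
have : s ^+ 2 * (phi y * y^-1) <= 0.
  by rewrite pmulr_rle0// pmulr_rle0// invr_le0 (ltW (lt_trans yx _)).
move: Ay; rewrite ltr_norml => /andP[_]; lra.
Qed.

Let g2_ge0 x : x < 0 -> 0 <= g2 x.
Proof.
move=> x0; apply/ler_addgt0Pr => e e0.
(* To the left of this point, s^2 phi(y)/|y| <= s^2 K/|y| < e/2; the other e/2 is for A(y). *)
pose u := Num.min x (- (2 * s ^+ 2 * K / e)).
have e20 : 0 < e / 2 by rewrite divr_gt0.
have [y yu Ay] := below u _ e20.
have [yx yk] : y < x /\ y < - (2 * s ^+ 2 * K / e).
  by apply/andP; rewrite -lt_min.
have y0 := lt_trans yx x0.
have dg z : y <= z <= x -> is_derive z 1 g2 (3 * s ^+ 4 * phi z * z^-1 ^+ 4).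
  by move=> /andP[_ zx]; exact: dg2 (le_lt_trans zx x0).
have [k /andP[yk' kx] E] := mean_value R g2 _ y x (ltW yx) dg.
have : g2 y <= g2 x.
  rewrite -subr_ge0 E mulr_ge0 ?subr_ge0 ?(ltW yx)//.
  by rewrite mulr_ge0 ?exprn_even_ge0// mulr_ge0 ?(ltW (phi0 _))// mulr_ge0// exprn_even_ge0.
have : - e <= g2 y; last lra.
have h1 : s ^+ 2 * (phi y * y^-1) >= - (e / 2).
  have yN : 0 < - y by rewrite oppr_gt0.
  have : 2 * s ^+ 2 * K < - y * e by rewrite -ltr_pdivrMr// ltrNr.
  have : s ^+ 2 * phi y <= s ^+ 2 * K by rewrite ler_wpM2l// ltW.
  move=> a b; have c : 2 * (s ^+ 2 * phi y) <= - y * e by lra.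
  rewrite mulrA -[y]opprK invrN mulrN lerN2 ler_pdivrMr// opprK; lra.
have h2 : s ^+ 4 * (phi y * (y^-1 * (y^-1 * y^-1))) <= 0.
  rewrite pmulr_rle0 ?exprn_gt0// pmulr_rle0// -expr2 -exprS.
  by rewrite exprn_odd_le0// invr_le0 ltW.
move: Ay; rewrite /g2 /g1 ltr_norml => /andP[]; lra.
Qed.

(** The middle and right-hand terms are [g1 x] and [g1 x - g2 x] multiplied by the negative number
    x/(s^2 phi(x)), so the bounds are the signs of [g1] and [g2]. *)
Lemma mills_ratio x : x < 0 ->
  0 <= 1 + x * A x / (s ^+ 2 * phi x) <= s ^+ 2 / x ^+ 2.
Proof.
move=> x0; have := g1_le0 _ x0; have := g2_ge0 _ x0.
have xN0 : x != 0 by rewrite lt_eqF.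
have sN0 : s != 0 by rewrite gt_eqF.
have pN0 : phi x != 0 by rewrite gt_eqF.
have w0 : x / (s ^+ 2 * phi x) < 0 by rewrite nmulr_rlt0// invr_gt0 mulr_gt0.
have -> : 1 + x * A x / (s ^+ 2 * phi x) = x / (s ^+ 2 * phi x) * g1 x.
  by rewrite /g1; field; rewrite xN0 sN0 pN0.
have -> : s ^+ 2 / x ^+ 2 = x / (s ^+ 2 * phi x) * (g1 x - g2 x).
  by rewrite /g2; field; rewrite xN0 sN0 pN0.
move=> g2x g1x; rewrite nmulr_rge0// g1x/= ler_nM2l//; lra.
Qed.

End mills_ratio.

Lemma uniformly_continuous_vanishing (R : realType) (g : R -> R) :
  continuous g ->
  (forall e : R, 0 < e -> exists K : R, forall x, K <= `|x| -> `|g x| <= e) ->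
  (exists M : R, forall x, `|g x| <= M) /\
  (forall e : R, 0 < e -> exists2 r : R, 0 < r &
    forall x y, `|x - y| < r -> `|g x - g y| <= e).
Proof.
move=> cg g0; split.
  have [K gK] := g0 _ ltr01.
  have [||c _ cM] := @EVT_max R (fun x => `|g x|) (- `|K|) `|K|.
  - by rewrite ge0_cp.
  - by apply: continuous_subspaceT => x; apply: continuous_comp; [exact: cg|exact: norm_continuous].
  exists (Num.max 1 `|g c|) => x; rewrite le_max.
  have [/gK ->//|xK] := leP K `|x|.
  rewrite cM ?orbT// in_itv/= -ler_norml.
  exact: le_trans (ltW xK) (ler_norm _).
move=> e e0.
have e20 : 0 < e / 2 by rewrite divr_gt0.
have [K gK] := g0 _ e20.
(* Compactness of the segment makes the radius uniform. As y is not confined to the segment, only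
   pairs with both points outside it remain, where each value is at most e/2. *)
have : \forall r \near 0^'+, `[- K, K]%classic `<=`
    [set x | forall y, `|x - y| < r -> `|g x - g y| <= e].
  apply: (compact_near_coveringP _).1; first exact: segment_compact.
  move=> x _.
  have /cvgr_dist_lt /(_ _ e20) /nbhs_ballP[r /= r0 xr] := cg x.
  have r20 : 0 < r / 2 by rewrite divr_gt0.
  exists (ball x (r / 2), [set z | 0 < z < r / 2]) => /=.
    split; first exact: nbhsx_ballx.
    near=> z; apply/andP; split; near: z; first exact: nbhs_right_gt.
    exact: nbhs_right_lt.
  move=> [x' d] /= [xx' /andP[d0 dr]] y x'y.
  have : ball x r x' by apply: le_ball xx'; lra.
  move=> /xr /= h1.
  have : ball x r y.
    rewrite /ball/=; move: xx'; rewrite /ball/= => xx'.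
    have := ler_distD x' x y. lra.
  move=> /xr /= h2.
  have := ler_distD (g x) (g x') (g y); rewrite (distrC (g x') (g x)); lra.
move=> h.
have : \forall r \near 0^'+, 0 < r /\ `[- K, K]%classic `<=`
    [set x | forall y, `|x - y| < r -> `|g x - g y| <= e].
  by near=> r; split; near: r => //; exact: nbhs_right_gt.
move=> /filter_ex[r [r0 Hr]]; exists r => // x y xy.
have [Kx|xK] := leP K `|x|; last first.
  by apply: Hr => //=; rewrite in_itv/= -ler_norml ltW.
have [Ky|yK] := leP K `|y|; last first.
  rewrite distrC; apply: Hr; last by rewrite distrC.
  by rewrite /= in_itv/= -ler_norml ltW.
have := ler_normB (g x) (g y); have := gK _ Kx; have := gK _ Ky; lra.
Unshelve. all: by end_near. Qed.

Section stein.
Context {R : realType} (s : R).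
Hypothesis s0 : 0 < s.
Local Notation mu := lebesgue_measure.
Local Notation phi := (normal_pdf 0 s).
Variables (a b : R).
Hypothesis ab : a < b.

Let sN0 : s != 0. Proof. by rewrite gt_eqF. Qed.
Let v0 : 0 < s ^+ 2. Proof. by rewrite exprn_gt0. Qed.
Let phi0 x : 0 < phi x. Proof. exact: normal_pdf_gt0. Qed.

Let h (x : R) : R := Num.max 0 (Num.min 1 ((b - x) / (b - a))).

Let continuous_h : continuous h.
Proof.
pose u (x : R) : R := (b - x) / (b - a).
have cu : continuous u.
  move=> x; apply: cvgM; last exact: cvg_cst.
  by apply: cvgB; [exact: cvg_cst|exact: cvg_id].
have c1 : continuous (cst 1 \min u).
  by move=> x; apply: continuous_min; [exact: cvg_cst|exact: cu].
by move=> x; apply: (@continuous_max _ _ (cst 0) (cst 1 \min u));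
  [exact: cvg_cst|exact: c1].
Qed.

Let h01 x : 0 <= h x <= 1.
Proof. by rewrite /h le_max lexx ge_max ler01 ge_min lexx. Qed.

Let h_left x : x <= a -> h x = 1.
Proof.
move=> xa; rewrite /h min_l ?max_r// ler_pdivlMr ?subr_gt0// mul1r lerD2l.
by rewrite lerN2.
Qed.

Let h_right x : b <= x -> h x = 0.
Proof.
move=> bx; rewrite /h max_l// ge_min; apply/orP; right.
by rewrite pmulr_lle0 ?invr_gt0 ?subr_gt0// subr_le0.
Qed.

Let Q (x : R) : R := \int[mu]_(t in `]-oo, x]) (h t * phi t).
Let dQ (x : R) : is_derive x 1 Q (h x * phi x).
Proof. exact: is_derive_integral_normal_pdf. Qed.

Let Phi := gaussian_cdf s.
Let dPhi (x : R) : is_derive x 1 Phi (phi x).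
Proof. exact: is_derive_gaussian_cdf. Qed.

(** This is E h(N(0, s^2)), since [h] vanishes beyond [b]. *)
Let c := Q b.

Let Q_left x : x <= a -> Q x = Phi x.
Proof.
move=> xa; rewrite /Phi gaussian_cdfE; apply: eq_Rintegral => t.
by rewrite inE/= in_itv/= => tx; rewrite h_left// (le_trans tx).
Qed.

Let Q_right x : b <= x -> Q x = c.
Proof.
move=> bx; have [k /andP[bk _] /eqP] := mean_value _ _ _ _ _ bx (fun z _ => dQ z).
by rewrite h_right// !mul0r subr_eq0 => /eqP.
Qed.

Let c_ge : Phi a <= c.
Proof.
rewrite -Q_left// -subr_ge0.
have [k _ ->] := mean_value _ _ _ _ _ (ltW ab) (fun z _ => dQ z).
have /andP[hk _] := h01 k.
by rewrite mulr_ge0 ?subr_ge0 ?(ltW ab)// mulr_ge0// ltW.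
Qed.

Let c_le : c <= Phi b.
Proof.
rewrite /Phi gaussian_cdfE; apply: le_Rintegral => //.
- exact: integrable_mul_normal_pdf.
- have := @integrable_mul_normal_pdf R s (fun=> 1) `]-oo, b]%classic.
  apply=> //; first by move=> x; exact: cvg_cst.
  by move=> x /=; rewrite ler01 lexx.
- by move=> x _; have /andP[_ hx] := h01 x; rewrite ler_wpM2r// ltW.
Qed.

Let Phi01 x : 0 <= Phi x <= 1.
Proof.
rewrite /Phi /gaussian_cdf fine_ge0//=.
by rewrite -lee_fin fineK ?fin_num_measure// probability_le1.
Qed.

Let c01 : 0 <= c <= 1.
Proof.
have /andP[a0 _] := Phi01 a; have /andP[_ b1] := Phi01 b.
by rewrite (le_trans a0)//= (le_trans c_le).
Qed.

(** With phi as integrating factor, the Stein equation reads (s^2 phi f)' = (h - c) phi, which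
    integrates to this formula. [f'] is read off the equation, so what has to be proved is that it
    is the derivative of [f]. *)
Let f x := (Q x - c * Phi x) * (s ^+ 2 * phi x)^-1.
Let f' x := (x * f x + h x - c) / s ^+ 2.

Let df (x : R) : is_derive x 1 f (f' x).
Proof.
have pN0 : phi x != 0 by rewrite gt_eqF.
have wN0 : s ^+ 2 * phi x != 0 by rewrite mulf_neq0// expf_neq0.
have dphi := is_derive_normal_pdf s s0 x.
have D1 := is_deriveB (dQ x) (is_deriveZ c (dPhi x)).
have D2 := @is_deriveV _ _ x _ 1 wN0 (is_deriveZ (s ^+ 2) dphi).
apply: (is_derive_eq (is_deriveM D1 D2)).
rewrite /GRing.scale /= !fctE/= /GRing.scale/= /f' /f.
by field; rewrite sN0 pN0.
Qed.

(** Where h = 1, the numerator of [f] is (1 - c) Phi, and [f'] is (1 - c)/s^2 times the quantity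
    bounded by Mills' ratio. *)
Let f'_left x : x <= a -> x < 0 -> `|f' x| <= (x ^+ 2)^-1.
Proof.
move=> xa x0; have pN0 : phi x != 0 by rewrite gt_eqF.
have -> : f' x = (1 - c) * (1 + x * Phi x / (s ^+ 2 * phi x)) / s ^+ 2.
  by rewrite /f' /f Q_left// h_left//; field; rewrite sN0 pN0.
have /andP[m0 m1] := mills_ratio s (normal_peak s) phi Phi s0 phi0
  (fun x => normal_pdf_ub 0 x sN0) (is_derive_normal_pdf s s0) dPhi
  (cvg_gaussian_cdfNy s) x x0.
have /andP[c0 c1] := c01.
have c10 : 0 <= 1 - c by rewrite subr_ge0.
rewrite ger0_norm; last by rewrite !mulr_ge0 ?invr_ge0 ?(ltW v0).
rewrite ler_pdivrMr// [leRHS]mulrC; apply: le_trans m1.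
by rewrite ler_piMl// lerBlDr lerDl.
Qed.

(** Where h = 0, the numerator is c (1 - Phi(x)). Reflection through 0 brings it back to Mills'
    ratio at -x for [B], also a primitive of phi vanishing at -oo. *)
Let f'_right x : b <= x -> 0 < x -> `|f' x| <= (x ^+ 2)^-1.
Proof.
move=> bx x0; have pN0 : phi x != 0 by rewrite gt_eqF.
pose B (y : R) := 1 - Phi (- y).
have dB (y : R) : is_derive y 1 B (phi y).
  have D := is_deriveB (is_derive_cst (1 : R) y 1)
    (@is_derive1_comp _ Phi -%R y _ _ (dPhi (- y)) (is_deriveNid y 1)).
  apply: (is_derive_eq D).
  by rewrite normal_pdf_even// sub0r mulrN1 opprK.
have B0 : B y @[y --> -oo] --> (0 : R).
  rewrite -(subrr (1 : R)); apply: cvgB; first exact: cvg_cst.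
  apply/cvgNy_compNP; rewrite /comp; under eq_fun do rewrite opprK.
  exact: cvg_gaussian_cdfy.
have xN0 : - x < 0 by rewrite oppr_lt0.
have /andP[m0 m1] := mills_ratio s (normal_peak s) phi B s0 phi0
  (fun x => normal_pdf_ub 0 x sN0) (is_derive_normal_pdf s s0) dB B0 _ xN0.
have E : f' x = - (c * (1 + - x * B (- x) / (s ^+ 2 * phi (- x))) / s ^+ 2).
  rewrite /B opprK normal_pdf_even// /f' /f Q_right// h_right//; field.
  by rewrite sN0 pN0.
have /andP[c0 c1] := c01.
rewrite E normrN ger0_norm; last by rewrite !mulr_ge0 ?invr_ge0 ?(ltW v0).
rewrite ler_pdivrMr// [leRHS]mulrC; rewrite sqrrN in m1; apply: le_trans m1.
by rewrite ler_piMl.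
Qed.

Let continuous_f' : continuous f'.
Proof.
move=> x; apply: cvgM; last exact: cvg_cst.
apply: cvgB; last exact: cvg_cst.
apply: cvgD; last exact: continuous_h.
apply: cvgM; first exact: cvg_id.
by have [dfx _] := df x; apply: differentiable_continuous; apply/derivable1_diffP.
Qed.

Lemma stein_solution : exists g g' : R -> R, exists k : R -> R, exists c0 : R,
  [/\ forall x : R, is_derive x 1 g (g' x),
      exists M : R, forall x, `|g' x| <= M,
      forall e : R, 0 < e -> exists2 r : R, 0 < r &
        forall x y, `|x - y| < r -> `|g' x - g' y| <= e,
      gaussian_cdf s a <= c0 <= gaussian_cdf s b &
      forall x, [/\ s ^+ 2 * g' x - x * g x = k x - c0,
        0 <= k x <= 1, x <= a -> k x = 1 & b <= x -> k x = 0]].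
Proof.
exists f, f', h, c.
have [|M g'u] := uniformly_continuous_vanishing _ _ continuous_f'.
  move=> e e0.
  (* The first two entries put x outside the ramp; the last two give 1/x^2 <= 1/|x| <= e. *)
  exists (Num.max (Num.max `|a| `|b|) (Num.max 1 e^-1)) => x.
  rewrite !ge_max => /andP[/andP[ax bx] /andP[x1 ex]].
  apply: (@le_trans _ _ (x ^+ 2)^-1).
    have [x0|x0] := ltP x 0.
      apply: f'_left => //; rewrite (ltr0_norm x0) in ax.
      by move: ax; have := ler_norm (- a); rewrite normrN; lra.
    apply: f'_right => //.
      by rewrite (ger0_norm x0) in bx; exact: le_trans (ler_norm _) bx.
    by rewrite lt_neqAle x0 andbT; apply: contraTneq x1 => <-; rewrite normr0 -ltNge.
  rewrite -[leRHS]invrK lef_pV2 ?posrE ?invr_gt0//.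
    by rewrite (le_trans ex)// -real_normK ?num_real// ler_eXnr.
  by rewrite -real_normK ?num_real// exprn_gt0// (lt_le_trans ltr01).
split => //; first by rewrite c_ge c_le.
move=> x; split => //; last exact: h_right; last exact: h_left.
by rewrite /f'; field.
Qed.

End stein.

(** * The central limit theorem *)

Lemma Rintegral_sum d (T : measurableType d) (R : realType)
    (mu : {measure set T -> \bar R}) (n : nat) (F : 'I_n -> T -> R) :
  (forall i, mu.-integrable setT (EFin \o F i)) ->
  \int[mu]_w (\sum_(i < n) F i w) = \sum_(i < n) \int[mu]_w F i w.
Proof.
move=> iF; rewrite /Rintegral.
under eq_integral do rewrite -sumEFin.
rewrite (@integral_sum _ _ _ mu setT measurableT 'I_n (fun i => EFin \o F i) iF).
by rewrite -sum_fine// => i _; exact: integrable_fin_num.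
Qed.

Lemma Rintegral_probability_cst d (T : measurableType d) (R : realType)
    (P : probability T R) (k : R) : \int[P]_w k = k.
Proof.
rewrite Rintegral_cst//; transitivity (k * fine (1 : \bar R)); last by rewrite mulr1.
by congr (_ * fine _); exact: probability_setT.
Qed.

Lemma integrable_bounded d (T : measurableType d) (R : realType)
    (P : probability T R) (f : T -> R) (M : R) :
  measurable_fun setT f -> (forall w, `|f w| <= M) ->
  P.-integrable setT (EFin \o f).
Proof.
move=> mf fM; apply: le_integrable (finite_measure_integrable_cst P M measurableT) => //.
  exact/measurable_EFinP.
by move=> w _ /=; rewrite lee_fin (le_trans (fM w))// ler_norm.
Qed.

Lemma integrable_sqr d (T : measurableType d) (R : realType)
    (P : probability T R) (f : T -> R) : measurable_fun setT f ->
  P.-integrable setT (EFin \o (fun w => f w ^+ 2)) ->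
  P.-integrable setT (EFin \o f).
Proof.
move=> mf if2.
apply: le_integrable (integrableD measurableT
  (finite_measure_integrable_cst P 1 measurableT) if2) => //.
  exact/measurable_EFinP.
move=> w _ /=; rewrite lee_fin [leRHS]ger0_norm ?addr_ge0 ?sqr_ge0//.
rewrite -(real_normK (num_real (f w))).
have := sqr_ge0 (`|f w| - 1 / 2); rewrite !expr2; lra.
Qed.

Section identical_distribution.
Context d (T : measurableType d) (R : realType) (P : probability T R).
Variables X Y : {RV P >-> R}.
Hypothesis XY : forall A, measurable A -> distribution P X A = distribution P Y A.
Variable g : R -> R.
Hypothesis mg : measurable_fun setT g.
Hypothesis ig : P.-integrable setT (EFin \o (g \o X)).

Lemma integrable_same_law : P.-integrable setT (EFin \o (g \o Y)).
Proof.
have mg' : measurable_fun setT (fun x => `|(g x)%:E|%E).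
  by apply: measurableT_comp => //; exact/measurable_EFinP.
have /integrableP[_] := ig.
rewrite -(ge0_integral_distribution X mg')//.
rewrite (eq_measure_integral (distribution P Y)); last by move=> A mA _; exact: XY.
rewrite ge0_integral_distribution// => h; apply/integrableP; split => //.
by apply/measurable_EFinP; exact: measurableT_comp.
Qed.

Lemma expectation_same_law : \int[P]_w g (X w) = \int[P]_w g (Y w).
Proof.
have mg' : measurable_fun setT (fun x => (g x)%:E) by exact/measurable_EFinP.
rewrite /Rintegral; congr fine.
rewrite -(integral_distribution mg' ig).
rewrite (eq_measure_integral (distribution P Y)); last by move=> A mA _; exact: XY.
by rewrite integral_distribution//; exact: integrable_same_law.
Qed.

End identical_distribution.

Lemma expectation_comp_mul d (T : measurableType d) (R : realType)
    (P : probability T R) (U V : T -> R) (k l : R -> R) :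
  measurable_fun setT U -> measurable_fun setT V ->
  (forall A B, measurable A -> measurable B ->
    P (U @^-1` A `&` V @^-1` B) = (P (U @^-1` A) * P (V @^-1` B))%E) ->
  measurable_fun setT k -> measurable_fun setT l ->
  P.-integrable setT (EFin \o (k \o U)) -> P.-integrable setT (EFin \o (l \o V)) ->
  P.-integrable setT (EFin \o (fun w => k (U w) * l (V w))) /\
  \int[P]_w (k (U w) * l (V w)) = (\int[P]_w k (U w)) * (\int[P]_w l (V w)).
Proof.
move=> mU mV UV mk ml ik il.
have mkU : measurable_fun setT (k \o U) by exact: measurableT_comp.
have mlV : measurable_fun setT (l \o V) by exact: measurableT_comp.
have I A B : measurable A -> measurable B ->
    P ((k \o U) @^-1` A `&` (l \o V) @^-1` B) =
    (P ((k \o U) @^-1` A) * P ((l \o V) @^-1` B))%E.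
  move=> mA mB; apply: (UV (k @^-1` A) (l @^-1` B)).
    by rewrite -[X in measurable X]setTI; exact: mk.
  by rewrite -[X in measurable X]setTI; exact: ml.
split.
  exact: (integrable_mul_independent _ _ _ _ _ _ mkU mlV I ik il).
exact: (expectation_mul_independent _ _ _ _ _ _ mkU mlV I ik il).
Qed.

(** * One summand in Stein's method *)

Section stein_step.
Context d (T : measurableType d) (R : realType) (P : probability T R).
Variables (g g' : R -> R) (M e r : R).
Hypothesis dg : forall x : R, is_derive x 1 g (g' x).
Hypothesis g'M : forall x, `|g' x| <= M.
Hypothesis mg' : measurable_fun setT g'.
Hypotheses (e0 : 0 <= e) (r0 : 0 < r).
Hypothesis g'r : forall x y, `|x - y| < r -> `|g' x - g' y| <= e.

(** Bounds the oscillation of g' over a distance |z|: by uniform continuity when |z| < r, by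
    boundedness otherwise. It is bounded in z, and modulus(t y) is e once t is small, as dominated
    convergence will require. *)
Definition modulus (z : R) : R := e + 2 * M * (r <= `|z|)%R%:R.

Let M0 : 0 <= M. Proof. exact: le_trans (normr_ge0 _) (g'M 0). Qed.

Let cg : continuous g.
Proof.
by move=> x; apply: differentiable_continuous; apply/derivable1_diffP; have [] := dg x.
Qed.

Lemma modulus_ge0 z : 0 <= modulus z.
Proof. by rewrite addr_ge0// !mulr_ge0. Qed.

Lemma modulus_le z : modulus z <= e + 2 * M.
Proof. by rewrite lerD2l ler_piMr ?mulr_ge0//; case: (r <= _). Qed.

Lemma measurable_modulus : measurable_fun setT modulus.
Proof.
rewrite /modulus; apply: measurable_funD => //; apply: measurable_funM => //.
rewrite (_ : (fun _ => _) = \1_[set z : R | r <= `|z|]); last first.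
  by apply/funext => z; rewrite indicE mem_setE.
apply: measurable_indic; rewrite -[X in measurable X]setTI.
by apply: measurable_fun_le => //; exact: normr_measurable.
Qed.

Lemma derivative_modulus x y z : `|x - y| <= `|z| -> `|g' x - g' y| <= modulus z.
Proof.
move=> xyz; rewrite /modulus; have [rz|zr] := leP r `|z|.
  rewrite mulr1; have := e0; have := ler_normB (g' x) (g' y); have := g'M x; have := g'M y; lra.
by rewrite mulr0 addr0 g'r// (le_lt_trans xyz).
Qed.

Lemma taylor_modulus x z : `|g (x + z) - g x - z * g' x| <= `|z| * modulus z.
Proof.
have [c xc ->] : exists2 c, `|c - x| <= `|z| & g (x + z) - g x = g' c * z.
  have [z0|z0] := leP 0 z.
    have [|c /andP[xc cxz] E] := mean_value R g g' x (x + z) _ (fun z _ => dg z).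
      by rewrite lerDl.
    exists c; first by rewrite !ger0_norm// ?subr_ge0// lerBlDl.
    by rewrite E addrAC subrr add0r.
  have [|c /andP[xc cxz] E] := mean_value R g g' (x + z) x _ (fun z _ => dg z).
    by rewrite gerDl ltW.
  exists c; first by rewrite ler0_norm ?subr_le0// ltr0_norm//; lra.
  by rewrite -opprB E; ring.
by rewrite mulrC -mulrBr normrM ler_wpM2l// derivative_modulus.
Qed.

Variables (U y : T -> R) (s t : R).
Hypotheses (mU : measurable_fun setT U) (my : measurable_fun setT y).
Hypothesis Uy : forall A B, measurable A -> measurable B ->
  P (U @^-1` A `&` y @^-1` B) = (P (U @^-1` A) * P (y @^-1` B))%E.
Hypothesis iU : P.-integrable setT (EFin \o U).
Hypothesis iy2 : P.-integrable setT (EFin \o (fun w => y w ^+ 2)).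
Hypotheses (Ey : \int[P]_w y w = 0) (Ey2 : \int[P]_w (y w ^+ 2) = s ^+ 2).

(** For t = n^(-1/2) and [U] the normalized sum without the summand t y, [D] is the share of that
    summand in s^2 g'(S) - S g(S). Expanding at [U] gives the terms [A1] and [A2], of mean 0 because
    y is independent of [U], centred and of variance s^2. The remainder [err] is of order t^2 times
    a small factor. *)
Let D w := t ^+ 2 * s ^+ 2 * g' (U w + t * y w) - t * y w * g (U w + t * y w).
Let A1 w := - t * (g (U w) * y w).
Let A2 w := t ^+ 2 * (g' (U w) * (s ^+ 2 - y w ^+ 2)).
Let err w := D w - A1 w - A2 w.
Let bnd w := (s ^+ 2 + y w ^+ 2) * modulus (t * y w).

Let err_le w : `|err w| <= t ^+ 2 * bnd w.
Proof.
have -> : err w = t ^+ 2 * s ^+ 2 * (g' (U w + t * y w) - g' (U w)) -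
    t * y w * (g (U w + t * y w) - g (U w) - t * y w * g' (U w)).
  by rewrite /err /D /A1 /A2; ring.
rewrite (le_trans (ler_normB _ _))//.
have -> : t ^+ 2 * bnd w = t ^+ 2 * s ^+ 2 * modulus (t * y w) +
    (t * y w) ^+ 2 * modulus (t * y w) by rewrite /bnd; ring.
apply: lerD.
  have h0 : 0 <= t ^+ 2 * s ^+ 2 by apply: mulr_ge0; exact: sqr_ge0.
  rewrite normrM (ger0_norm h0) ler_wpM2l//.
  by apply: derivative_modulus; rewrite addrAC subrr add0r.
rewrite normrM -(real_normK (num_real (t * y w))) expr2 -[leRHS]mulrA ler_wpM2l//.
exact: taylor_modulus.
Qed.

Lemma integrable_stein_bound : P.-integrable setT (EFin \o bnd).
Proof.
have i1 : P.-integrable setT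
    (fun w => (e + 2 * M)%:E * ((s ^+ 2)%:E + (y w ^+ 2)%:E))%E.
  apply: integrableZl => //; apply: integrableD => //.
  exact: finite_measure_integrable_cst.
apply: le_integrable i1 => //.
  apply/measurable_EFinP; apply: measurable_funM.
    by apply: measurable_funD => //; exact: measurable_funX.
  by apply: measurableT_comp; [exact: measurable_modulus|exact: measurable_funM].
move=> w _ /=; rewrite lee_fin normrM mulrC normrM.
rewrite !(ger0_norm (modulus_ge0 _)) (@ger0_norm _ (e + 2 * M)) ?addr_ge0 ?mulr_ge0//.
by rewrite ler_wpM2r// modulus_le.
Qed.

Let mg : measurable_fun setT g. Proof. exact: continuous_measurable_fun. Qed.

Let iy : P.-integrable setT (EFin \o y). Proof. exact: integrable_sqr. Qed.

(** A bounded derivative gives linear growth: |g(u)| <= |g(0)| + M |u|. *)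
Let igU : P.-integrable setT (EFin \o (g \o U)).
Proof.
have i1 : P.-integrable setT (fun w => (`|g 0|)%:E + M%:E * (U w)%:E)%E.
  apply: integrableD => //; first exact: finite_measure_integrable_cst.
  exact: integrableZl.
have i2 : P.-integrable setT (fun w => (`|g 0|)%:E + M%:E * (`|U w|)%:E)%E.
  apply: integrableD => //; first exact: finite_measure_integrable_cst.
  by apply: integrableZl => //; exact: (integrable_norm iU).
apply: le_integrable i2 => //.
  by apply/measurable_EFinP; exact: measurableT_comp.
move=> w _ /=; rewrite lee_fin [leRHS]ger0_norm ?addr_ge0 ?mulr_ge0//.
suff H : `|g (U w) - g 0| <= M * `|U w|.
  have := ler_normD (g (U w) - g 0) (g 0); rewrite subrK; lra.
have [u0|u0] := leP 0 (U w).
  have [c _ ->] := mean_value R g g' _ _ u0 (fun z _ => dg z).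
  by rewrite subr0 normrM ler_wpM2r.
have [c _ E] := mean_value R g g' _ _ (ltW u0) (fun z _ => dg z).
by rewrite -opprB E sub0r normrN normrM normrN ler_wpM2r.
Qed.

Let A1P : P.-integrable setT (EFin \o A1) /\ \int[P]_w A1 w = 0.
Proof.
have [i1 E1] := expectation_comp_mul _ _ _ P U y g idfun mU my Uy mg
  (@measurable_id _ _ setT) igU iy.
split; first exact: (integrableZl measurableT (- t) i1).
by rewrite /A1 RintegralZl// E1/= Ey mulr0 mulr0.
Qed.

Let A2P : P.-integrable setT (EFin \o A2) /\ \int[P]_w A2 w = 0.
Proof.
have mg'U : measurable_fun setT (g' \o U) by exact: measurableT_comp.
have ig'U := integrable_bounded _ _ _ P (g' \o U) M mg'U (fun w => g'M (U w)).
have i2 : P.-integrable setT (EFin \o (fun w => s ^+ 2 - y w ^+ 2)).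
  exact: (integrableB measurableT
    (finite_measure_integrable_cst P (s ^+ 2) measurableT) iy2).
have mk : measurable_fun setT (fun x : R => s ^+ 2 - x ^+ 2).
  by apply: measurable_funB => //; exact: measurable_funX.
have [i1 E1] := expectation_comp_mul _ _ _ P U y g' (fun x => s ^+ 2 - x ^+ 2)
  mU my Uy mg' mk ig'U i2.
split; first exact: (integrableZl measurableT (t ^+ 2) i1).
rewrite /A2 RintegralZl// E1/= RintegralB//; last exact: finite_measure_integrable_cst.
by rewrite Rintegral_probability_cst Ey2 subrr mulr0 mulr0.
Qed.

Let mD : measurable_fun setT D.
Proof.
have mS : measurable_fun setT (fun w => U w + t * y w).
  by apply: measurable_funD => //; exact: measurable_funM.
apply: measurable_funB; apply: measurable_funM => //.
- by apply: measurableT_comp.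
- exact: measurable_funM.
- by apply: measurableT_comp.
Qed.

Let ierr : P.-integrable setT (EFin \o err).
Proof.
have [/measurable_int/measurable_EFinP m1 _] := A1P.
have [/measurable_int/measurable_EFinP m2 _] := A2P.
apply: le_integrable (integrableZl measurableT (t ^+ 2) integrable_stein_bound) => //.
  by apply/measurable_EFinP; do 2 apply: measurable_funB => //.
move=> w _ /=; rewrite lee_fin (le_trans (err_le w))//.
exact: ler_norm.
Qed.

Lemma integrable_stein_step : P.-integrable setT (EFin \o D).
Proof.
have [i1 _] := A1P; have [i2 _] := A2P.
have -> : EFin \o D = (fun w => (err w)%:E + ((A1 w)%:E + (A2 w)%:E))%E.
  by apply/funext => w /=; rewrite -!EFinD; congr EFin; rewrite /err; ring.
by apply: integrableD => //; exact: integrableD.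
Qed.

Lemma stein_step : `|\int[P]_w D w| <= t ^+ 2 * \int[P]_w bnd w.
Proof.
have [i1 E1] := A1P; have [i2 E2] := A2P.
have -> : \int[P]_w D w = \int[P]_w err w.
  have -> : D = (fun w => err w + (A1 w + A2 w)).
    by apply/funext => w /=; rewrite /err; ring.
  rewrite (@RintegralD _ _ _ P setT err (fun w => A1 w + A2 w))//; last first.
    exact: (integrableD measurableT i1 i2).
  by rewrite (@RintegralD _ _ _ P setT A1 A2)// E1 E2 !addr0.
rewrite (le_trans (le_normr_Rintegral measurableT ierr))//.
rewrite -RintegralZl//; last exact: integrable_stein_bound.
apply: le_Rintegral => //.
- exact: (integrable_norm ierr).
- exact: (integrableZl measurableT (t ^+ 2) integrable_stein_bound).
Qed.

End stein_step.

Section central_limit_theorem.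
Context d (T : measurableType d) (R : realType) (P : probability T R).
Variables (Y : nat -> {RV P >-> R}) (s : R).
Hypothesis indY : mutually_independent P Y.
Hypothesis idY : identically_distributed P Y.
Hypothesis iY2 : P.-integrable setT (EFin \o (fun w => Y 0%N w ^+ 2)).
Hypotheses (EY : \int[P]_w Y 0%N w = 0) (EY2 : \int[P]_w (Y 0%N w ^+ 2) = s ^+ 2).

Definition normalized_sum n w := (Num.sqrt n%:R)^-1 * \sum_(i < n) Y i w.

Lemma measurable_normalized_sum n : measurable_fun setT (normalized_sum n).
Proof.
rewrite /normalized_sum; apply: measurable_funM; first exact: measurable_cst.
by apply: measurable_sum => i; exact: measurable_funPT.
Qed.

Let msq : measurable_fun setT (fun x : R => x ^+ 2).
Proof. exact: measurable_funX. Qed.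

Let integrable_Y2 i : P.-integrable setT (EFin \o (fun w => Y i w ^+ 2)).
Proof. exact: (integrable_same_law _ _ _ P _ _ (idY 0%N i) _ msq iY2). Qed.

Let integrable_Y i : P.-integrable setT (EFin \o Y i).
Proof. exact: integrable_sqr. Qed.

Let mean_Y i : \int[P]_w Y i w = 0.
Proof.
rewrite -[RHS]EY; apply/esym.
exact: (expectation_same_law _ _ _ P _ _ (idY 0%N i) idfun
  (@measurable_id _ _ setT) (integrable_Y 0%N)).
Qed.

Let var_Y i : \int[P]_w (Y i w ^+ 2) = s ^+ 2.
Proof.
rewrite -[RHS]EY2; apply/esym.
exact: (expectation_same_law _ _ _ P _ _ (idY 0%N i) _ msq iY2).
Qed.

Section stein_bound.
Variables (g g' : R -> R) (M e r : R).
Hypothesis dg : forall x : R, is_derive x 1 g (g' x).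
Hypothesis g'M : forall x, `|g' x| <= M.
Hypothesis mg' : measurable_fun setT g'.
Hypotheses (e0 : 0 <= e) (r0 : 0 < r).
Hypothesis g'r : forall x y, `|x - y| < r -> `|g' x - g' y| <= e.

Let bnd n w := (s ^+ 2 + Y 0%N w ^+ 2) * modulus R M e r ((Num.sqrt n%:R)^-1 * Y 0%N w).

(** Each of the n summands contributes at most t^2 E [bnd], the same for all by identical
    distribution, and n t^2 = 1. *)
Lemma stein_sum n : (0 < n)%N ->
  P.-integrable setT (EFin \o (fun w => s ^+ 2 * g' (normalized_sum n w) -
    normalized_sum n w * g (normalized_sum n w))) /\
  `|\int[P]_w (s ^+ 2 * g' (normalized_sum n w) -
    normalized_sum n w * g (normalized_sum n w))| <= \int[P]_w bnd n w.
Proof.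
move=> n0; pose t : R := (Num.sqrt n%:R)^-1.
have nt : n%:R * t ^+ 2 = 1.
  by rewrite exprVn sqr_sqrtr ?ler0n// divff// pnatr_eq0 -lt0n.
pose U i w := t * \sum_(j < n | j != i :> nat) Y j w.
pose D i w := t ^+ 2 * s ^+ 2 * g' (U i w + t * Y i w) -
  t * Y i w * g (U i w + t * Y i w).
have US (i : 'I_n) w : U i w + t * Y i w = normalized_sum n w.
  rewrite /U -mulrDr /normalized_sum; congr (_ * _).
  by rewrite [in RHS](bigD1 i)//= [RHS]addrC.
have mU i : measurable_fun setT (U i).
  apply: measurable_funM; first exact: measurable_cst.
  rewrite (_ : (fun _ => _) =
      fun w => \sum_(j < n) (if j != i :> nat then Y j w else 0)).
    by apply: measurable_sum => j; case: (j != i :> nat);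
      [exact: measurable_funPT|exact: measurable_cst].
  by apply/funext => w; rewrite big_mkcond.
have iU i : P.-integrable setT (EFin \o U i).
  rewrite (_ : EFin \o U i = fun w => (t%:E *
      \sum_(j < n | j != i :> nat) (Y j w)%:E)%E); last first.
    by apply/funext => w /=; rewrite EFinM sumEFin.
  apply: integrableZl => //; apply: integrable_sum => // j _.
  exact: integrable_Y.
have indU i A B : measurable A -> measurable B ->
    P (U i @^-1` A `&` Y i @^-1` B) = (P (U i @^-1` A) * P (Y i @^-1` B))%E.
  move=> mA mB.
  apply: (independent_leave_one_out _ _ _ P Y indY n i (( *%R t) @^-1` A) B) => //.
  rewrite -[X in measurable X]setTI.
  have mt : measurable_fun setT (fun x : R => t * x) by exact: measurable_funM.
  exact: mt.
have mYi (i : nat) : measurable_fun setT (Y i) by exact: measurable_funPT.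
have iD i := integrable_stein_step _ _ _ P g g' M e r dg g'M mg' e0 g'r (U i) (Y i)
  s t (mU i) (mYi i) (indU i) (iU i) (integrable_Y2 i) (mean_Y i) (var_Y i).
have bD i := stein_step _ _ _ P g g' M e r dg g'M mg' e0 g'r (U i) (Y i)
  s t (mU i) (mYi i) (indU i) (iU i) (integrable_Y2 i) (mean_Y i) (var_Y i).
have sumD : (fun w => s ^+ 2 * g' (normalized_sum n w) -
    normalized_sum n w * g (normalized_sum n w)) = fun w => \sum_(i < n) D i w.
  apply/funext => w; rewrite sumrB; congr (_ - _).
    under eq_bigr do rewrite US.
    rewrite sumr_const card_ord -mulr_natl.
    by rewrite (_ : n%:R * _ = n%:R * t ^+ 2 * (s ^+ 2 * g' (normalized_sum n w)));
      [rewrite nt mul1r|ring].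
  under eq_bigr do rewrite US.
  by rewrite -mulr_suml {1}/normalized_sum mulr_sumr.
have mS : measurable_fun setT (fun x : R => (s ^+ 2 + x ^+ 2) * modulus R M e r (t * x)).
  apply: measurable_funM.
    by apply: measurable_funD => //; exact: measurable_funX.
  apply: measurableT_comp; last exact: measurable_funM.
  exact: measurable_modulus.
have Ebnd (i : 'I_n) : \int[P]_w ((s ^+ 2 + Y i w ^+ 2) * modulus R M e r (t * Y i w)) =
    \int[P]_w bnd n w.
  apply/esym; apply: (expectation_same_law _ _ _ P _ _ (idY 0%N i) _ mS).
  exact: (integrable_stein_bound _ _ _ P g').
rewrite sumD; split.
  rewrite (_ : EFin \o _ = fun w => (\sum_(i < n) (D i w)%:E)%E); last first.
    by apply/funext => w /=; rewrite sumEFin.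
  by apply: integrable_sum => // i _; exact: iD.
rewrite Rintegral_sum; last by move=> i; exact: iD.
rewrite (le_trans (ler_norm_sum _ _ _))//.
have -> : \int[P]_w bnd n w = \sum_(i < n) (t ^+ 2 * \int[P]_w bnd n w).
  by rewrite sumr_const card_ord -mulr_natl mulrA nt mul1r.
by apply: ler_sum => i _; rewrite -(Ebnd i); exact: bD.
Qed.

(** At each point, |Y| / sqrt n < r as soon as n > (|Y| / r)^2, and the modulus is then e. The limit
    is e E(s^2 + Y^2), and e + 2 M gives an integrable dominating function. *)
Lemma cvg_stein_bound : \int[P]_w bnd n w @[n --> \oo] --> 2 * s ^+ 2 * e.
Proof.
have lim : \int[P]_w ((s ^+ 2 + Y 0%N w ^+ 2) * e) = 2 * s ^+ 2 * e.
  have i1 : P.-integrable setT (EFin \o (fun=> s ^+ 2)).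
    exact: finite_measure_integrable_cst.
  rewrite RintegralZr//; last exact: (integrableD measurableT i1 iY2).
  by rewrite RintegralD// Rintegral_probability_cst EY2; ring.
have iL c : P.-integrable setT
    (EFin \o (fun w => (s ^+ 2 + Y 0%N w ^+ 2) * c)).
  have i1 : P.-integrable setT (EFin \o (fun=> s ^+ 2)).
    exact: finite_measure_integrable_cst.
  rewrite (_ : EFin \o _ = fun w => (c%:E *
      ((s ^+ 2)%:E + (Y 0%N w ^+ 2)%:E))%E); last first.
    by apply/funext => w /=; rewrite mulrC -EFinD -EFinM.
  by apply: integrableZl => //; exact: (integrableD measurableT i1 iY2).
rewrite -lim; apply: fine_cvg; rewrite fineK; last exact: integrable_fin_num (iL e).
apply: (dominated_cvg measurableT _ _ _ (iL (e + 2 * M))) => //.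
- move=> n; apply/measurable_EFinP; apply: measurable_funM.
    by apply: measurable_funD => //; exact: measurable_funX.
  by apply: measurableT_comp; [exact: measurable_modulus|exact: measurable_funM].
- move=> w _; apply: cvg_near_cst.
  have := nbhs_infty_gtr ((`|Y 0%N w| / r) ^+ 2).
  apply: filterS => n nY; rewrite /bnd /modulus.
  rewrite (_ : (r <= _) = false) ?mulr0 ?addr0//; apply/negbTE; rewrite -ltNge.
  have n0 : 0 < Num.sqrt n%:R :> R by rewrite sqrtr_gt0 (le_lt_trans _ nY)// sqr_ge0.
  rewrite normrM (@ger0_norm _ (_^-1)) ?invr_ge0 ?(ltW n0)//.
  rewrite mulrC ltr_pdivrMr// mulrC -ltr_pdivrMr//.
  rewrite -[ltLHS]ger0_norm ?divr_ge0 ?(ltW r0)// -sqrtr_sqr ltr_sqrt//.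
  by rewrite (le_lt_trans _ nY)// sqr_ge0.
- move=> n w _ /=; rewrite lee_fin ger0_norm; last first.
    by apply: mulr_ge0; [rewrite addr_ge0 ?sqr_ge0|exact: (modulus_ge0 _ g')].
  by apply: ler_wpM2l; [rewrite addr_ge0 ?sqr_ge0|exact: (modulus_le _ g')].
Qed.

End stein_bound.
(** For g = id the Stein integrand is s^2 - S^2, whose integrability [stein_sum] provides. Here g' =
    1 has bound 1 and oscillation 0. *)
Lemma integrable_normalized_sum_sqr n : (0 < n)%N ->
  P.-integrable setT (EFin \o (fun w => normalized_sum n w ^+ 2)).
Proof.
move=> n0.
have [iD _] := stein_sum id (cst 1) 1 0 1 (fun x => is_derive_id x (1 : R))
  (fun=> ltac:(by rewrite /= normr1)) (measurable_cst _) (lexx 0)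
  (fun x y _ => ltac:(by rewrite /= subrr normr0)) n n0.
have := integrableB measurableT
  (finite_measure_integrable_cst P (s ^+ 2) measurableT) iD.
apply: eq_integrable => // w _ /=.
by rewrite -EFinB mulr1 opprB addrC subrK expr2.
Qed.

(* Stein's identity for g(x) = x, for which the remainder vanishes in the limit. *)
Lemma cvg_second_moment :
  \int[P]_w (normalized_sum n w ^+ 2) @[n --> \oo] --> s ^+ 2.
Proof.
apply/cvgrPdist_le => e e0.
have c1 (x : R) : `|(cst 1 : R -> R) x| <= 1 by rewrite /= normr1.
have c2 (x y : R) : `|x - y| < 1 -> `|(cst 1 : R -> R) x - cst 1 y| <= 0.
  by move=> _; rewrite /= subrr normr0.
have /cvgrPdist_le/(_ _ e0) := cvg_stein_bound (cst 1) 1 0 1 c1 (lexx 0) ltr01.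
apply: filterS2 (nbhs_infty_gt 0%N) => n n0; rewrite mulr0 sub0r normrN => Be.
have [_ D] := stein_sum id (cst 1) 1 0 1 (fun x => is_derive_id x (1 : R)) c1
  (measurable_cst _) (lexx 0) c2 n n0.
apply: le_trans (le_trans (ler_norm _) Be); apply: le_trans D.
have -> : \int[P]_w (s ^+ 2 * cst 1 (normalized_sum n w) -
    normalized_sum n w * id (normalized_sum n w)) =
    \int[P]_w (s ^+ 2 - normalized_sum n w ^+ 2).
  by apply: eq_Rintegral => w _; rewrite /= mulr1 expr2.
rewrite RintegralB//; first by rewrite Rintegral_probability_cst.
- exact: finite_measure_integrable_cst.
- exact: integrable_normalized_sum_sqr.
Qed.

(** Chebyshev's inequality with the limiting second moment. As s = 0 is allowed, it yields
    convergence to 0 in the degenerate case as well as tightness in general. *)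
Lemma normalized_sum_tail (K e : R) : 0 < K -> 0 < e -> \forall n \near \oo,
  fine (P [set w | K <= `|normalized_sum n w|]) <= (s ^+ 2 + e) / K ^+ 2.
Proof.
move=> K0 e0; have /cvgrPdist_le/(_ _ e0) := cvg_second_moment.
apply: filterS2 (nbhs_infty_gt 0%N) => n n0.
rewrite ler_norml => /andP[He _].
have K20 : 0 < K ^+ 2 by rewrite exprn_gt0.
have mA : measurable [set w | K <= `|normalized_sum n w|].
  rewrite -[X in measurable X]setTI; apply: measurable_fun_le => //.
  by apply: measurableT_comp => //; exact: measurable_normalized_sum.
rewrite ler_pdivlMr// mulrC.
have -> : K ^+ 2 * fine (P [set w | K <= `|normalized_sum n w|]) =
    \int[P]_w (K ^+ 2 * \1_[set w | K <= `|normalized_sum n w|] w).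
  rewrite RintegralZl//; last exact: integrable_indic.
  by rewrite [in RHS]/Rintegral integral_indic// setIT.
have : \int[P]_w (K ^+ 2 * \1_[set w | K <= `|normalized_sum n w|] w) <=
    \int[P]_w (normalized_sum n w ^+ 2); last lra.
apply: le_Rintegral => //.
- exact: (integrableZl measurableT (K ^+ 2) (integrable_indic P mA)).
- exact: integrable_normalized_sum_sqr.
move=> w _; rewrite indicE; case: (boolP (_ \in _)); last by rewrite mulr0 sqr_ge0.
rewrite inE /= mulr1 => Kw; rewrite -[leRHS]real_normK ?num_real//.
by rewrite lerXn2r ?nnegrE// ltW.
Qed.

Hypothesis s0 : 0 < s.

(** The ramp k lies between the indicators of the half-lines ending at a and at b, its expectation
    at S_n is within e of c, and c lies between the values of the limit at a and b. *)
Let clt_ramp (a b e : R) : a < b -> 0 < e -> \forall n \near \oo,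
  fine (P [set w | normalized_sum n w <= a]) <= gaussian_cdf s b + e /\
  gaussian_cdf s a - e <= fine (P [set w | normalized_sum n w <= b]).
Proof.
move=> ab e0.
have [g [g' [k [c [dg [M g'M] g'u /andP[ac cb] kE]]]]] := stein_solution s s0 a b ab.
have v0 : 0 < s ^+ 2 by rewrite exprn_gt0.
(* Makes the limit 2 s^2 e1 of the Stein bound equal to e/2. *)
pose e1 := e / (4 * s ^+ 2).
have e10 : 0 < e1 by rewrite divr_gt0// mulr_gt0.
have [r r0 g'r] := g'u _ e10.
have cg' : continuous g'.
  move=> x; apply/cvgrPdist_le => z z0; have [q q0 g'q] := g'u _ z0.
  by apply/nbhs_ballP; exists q => //= y xy; exact: g'q.
have mg' : measurable_fun setT g' by exact: continuous_measurable_fun.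
have /cvgrPdist_le := cvg_stein_bound g' M e1 r g'M (ltW e10) r0.
have e20 : 0 < e / 2 by rewrite divr_gt0.
move=> /(_ _ e20); apply: filterS2 (nbhs_infty_gt 0%N) => n n0 Bn.
have [iD bD] := stein_sum g g' M e1 r dg g'M mg' (ltW e10) g'r n n0.
have De : `|\int[P]_w (k (normalized_sum n w) - c)| <= e.
  have -> : \int[P]_w (k (normalized_sum n w) - c) =
      \int[P]_w (s ^+ 2 * g' (normalized_sum n w) -
        normalized_sum n w * g (normalized_sum n w)).
    by apply: eq_Rintegral => w _; have [-> _ _ _] := kE (normalized_sum n w).
  apply: (le_trans bD); move: Bn.
  have -> : 2 * s ^+ 2 * e1 = e / 2 by rewrite /e1; field; rewrite gt_eqF.
  by rewrite ler_norml; lra.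
have mSn := measurable_normalized_sum n.
have mle x : measurable [set w | normalized_sum n w <= x].
  rewrite -[X in measurable X]setTI; exact: measurable_fun_le.
have ik : P.-integrable setT (EFin \o (fun w => k (normalized_sum n w) - c)).
  rewrite (_ : (fun w => _) = (fun w => s ^+ 2 * g' (normalized_sum n w) -
      normalized_sum n w * g (normalized_sum n w))) //.
  by apply/funext => w; have [-> _ _ _] := kE (normalized_sum n w).
have iI x : P.-integrable setT
    (EFin \o (fun w => \1_[set w | normalized_sum n w <= x] w - c)).
  exact: (integrableB measurableT (integrable_indic P (mle x))
    (finite_measure_integrable_cst P c measurableT)).
have EI x : \int[P]_w (\1_[set w | normalized_sum n w <= x] w - c) =
    fine (P [set w | normalized_sum n w <= x]) - c.
  rewrite RintegralB//; [|exact: integrable_indic|exact: finite_measure_integrable_cst].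
  by rewrite Rintegral_probability_cst /Rintegral integral_indic// setIT.
have h1 : fine (P [set w | normalized_sum n w <= a]) - c <=
    \int[P]_w (k (normalized_sum n w) - c).
  rewrite -EI; apply: le_Rintegral => // w _; rewrite lerB// indicE.
  have [_ /andP[k0 _] ka _] := kE (normalized_sum n w).
  by case: (boolP (_ \in _)) => //; rewrite inE => /ka ->.
have h2 : \int[P]_w (k (normalized_sum n w) - c) <=
    fine (P [set w | normalized_sum n w <= b]) - c.
  rewrite -EI; apply: le_Rintegral => // w _; rewrite lerB// indicE.
  have [_ /andP[_ k1] _ kb] := kE (normalized_sum n w).
  case: (boolP (_ \in _)) => //; rewrite notin_setE /= => /negP; rewrite -ltNge.
  by move=> /ltW /kb ->.
move: De; rewrite ler_norml => /andP[De1 De2]; split; lra.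
Qed.

Theorem central_limit x :
  fine (P [set w | normalized_sum n w <= x]) @[n --> \oo] --> gaussian_cdf s x.
Proof.
apply/cvgrPdist_le => e e0.
pose K := normal_peak s.
have K0 : 0 < K by rewrite normal_peak_gt0// gt_eqF.
have e20 : 0 < e / 2 by rewrite divr_gt0.
(* [K] is a Lipschitz constant of the limit, so widening the ramp to [z] on either side of x costs
   at most e/2. *)
pose z := e / (2 * K).
have z0 : 0 < z by rewrite divr_gt0// mulr_gt0.
have Kz : K * z = e / 2 by rewrite /z; field; rewrite gt_eqF.
have xz : x < x + z by rewrite ltrDl.
have zx : x - z < x by rewrite ltrBlDr ltrDl.
have := gaussian_cdf_lipschitz s s0 (x + z) x.
rewrite (_ : x + z - x = z) ?(gtr0_norm z0); last by ring.
rewrite -/K Kz ler_norml => /andP[_ l1].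
have := gaussian_cdf_lipschitz s s0 x (x - z).
rewrite (_ : x - (x - z) = z) ?(gtr0_norm z0); last by ring.
rewrite -/K Kz ler_norml => /andP[_ l2].
near=> n.
have [u1 _] : fine (P [set w | normalized_sum n w <= x]) <=
      gaussian_cdf s (x + z) + e / 2 /\
  gaussian_cdf s x - e / 2 <= fine (P [set w | normalized_sum n w <= x + z]).
  by near: n; exact: clt_ramp.
have [_ u2] : fine (P [set w | normalized_sum n w <= x - z]) <=
      gaussian_cdf s x + e / 2 /\
  gaussian_cdf s (x - z) - e / 2 <= fine (P [set w | normalized_sum n w <= x]).
  by near: n; exact: clt_ramp.
rewrite ler_norml; apply/andP; split; lra.
Unshelve. all: by end_near. Qed.

End central_limit_theorem.

(** * Asymptotic normality of the self-normalized sum *)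

Definition normal_cdf (R : realType) (v x : R) : R := fine (normal_law 0 v `]-oo, x]).

Lemma normal_cdfE (R : realType) (s x : R) : 0 < s ->
  normal_cdf R (s ^+ 2) x = gaussian_cdf s x.
Proof.
move=> s0; have v0 : 0 < s ^+ 2 by rewrite exprn_gt0.
by rewrite /normal_cdf /normal_law (gt_eqF v0) sqrtr_sqr (gtr0_norm s0).
Qed.

Lemma normal_cdf0 (R : realType) (x : R) : normal_cdf R 0 x = (0 <= x)%R%:R.
Proof. by rewrite /normal_cdf /normal_law eqxx diracE mem_setE in_itv. Qed.

Lemma fine_probability_le d (T : measurableType d) (R : realType)
    (P : probability T R) (A B : set T) : measurable A -> measurable B ->
  A `<=` B -> fine (P A) <= fine (P B).
Proof.
by move=> mA mB AB; rewrite fine_le ?fin_num_measure// le_measure ?inE.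
Qed.

Lemma fine_probability_leU d (T : measurableType d) (R : realType)
    (P : probability T R) (A B C : set T) : measurable A -> measurable B ->
  measurable C -> A `<=` B `|` C -> fine (P A) <= fine (P B) + fine (P C).
Proof.
move=> mA mB mC ABC; rewrite -fineD ?fin_num_measure//.
apply: fine_le; rewrite ?fin_numD ?fin_num_measure//.
apply: (@le_trans _ _ (P (B `|` C))); last exact: measureU2.
by rewrite le_measure ?inE//; exact: measurableU.
Qed.

Lemma fine_probability_ge0 d (T : measurableType d) (R : realType)
    (P : probability T R) (A : set T) : 0 <= fine (P A).
Proof. exact: fine_ge0. Qed.

Lemma fine_probability_le1 d (T : measurableType d) (R : realType)
    (P : probability T R) (A : set T) : measurable A -> fine (P A) <= 1.
Proof.
by move=> mA; rewrite -lee_fin fineK ?fin_num_measure// probability_le1.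
Qed.

Lemma fine_probability_setC d (T : measurableType d) (R : realType)
    (P : probability T R) (A : set T) : measurable A ->
  fine (P (~` A)) = 1 - fine (P A).
Proof. by move=> mA; rewrite probability_setC// fineB ?fin_num_measure. Qed.

Section clt_sandwich.
Context d (T : measurableType d) (R : realType) (P : probability T R).
Variables (Y : nat -> {RV P >-> R}) (s : R).
Hypothesis indY : mutually_independent P Y.
Hypothesis idY : identically_distributed P Y.
Hypothesis iY2 : P.-integrable setT (EFin \o (fun w => Y 0%N w ^+ 2)).
Hypotheses (EY : \int[P]_w Y 0%N w = 0) (EY2 : \int[P]_w (Y 0%N w ^+ 2) = s ^+ 2).
Local Notation S := (normalized_sum _ _ _ P Y).

Let mS n x : measurable [set w | S n w <= x].
Proof.
rewrite -[X in measurable X]setTI; apply: measurable_fun_le => //.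
exact: measurable_normalized_sum.
Qed.

Let mabs n x : measurable [set w | x <= `|S n w|].
Proof.
rewrite -[X in measurable X]setTI; apply: measurable_fun_le => //.
by apply: measurableT_comp => //; exact: measurable_normalized_sum.
Qed.

Let sandwich_pos (y e : R) : 0 < s -> 0 < e -> exists2 h : R, 0 < h &
  \forall n \near \oo,
    fine (P [set w | S n w <= y + h]) <= normal_cdf R (s ^+ 2) y + e /\
    normal_cdf R (s ^+ 2) y - e <= fine (P [set w | S n w <= y - h]).
Proof.
move=> s0 e0; rewrite !normal_cdfE//.
pose K := normal_peak s.
have K0 : 0 < K by rewrite normal_peak_gt0// gt_eqF.
have e20 : 0 < e / 2 by rewrite divr_gt0.
pose h := e / (2 * K).
have h0 : 0 < h by rewrite divr_gt0// mulr_gt0.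
have Kh : K * h = e / 2 by rewrite /h; field; rewrite gt_eqF.
exists h => //.
have := gaussian_cdf_lipschitz s s0 (y + h) y.
rewrite (_ : y + h - y = h) ?(gtr0_norm h0); last by ring.
rewrite -/K Kh ler_norml => /andP[_ l1].
have := gaussian_cdf_lipschitz s s0 y (y - h).
rewrite (_ : y - (y - h) = h) ?(gtr0_norm h0); last by ring.
rewrite -/K Kh ler_norml => /andP[_ l2].
have /cvgrPdist_le/(_ _ e20) := central_limit _ _ _ P Y s indY idY iY2 EY EY2 s0 (y + h).
have /cvgrPdist_le/(_ _ e20) := central_limit _ _ _ P Y s indY idY iY2 EY EY2 s0 (y - h).
apply: filterS2 => n; rewrite !ler_norml => /andP[a1 a2] /andP[b1 b2].
clear - l1 l2 a1 a2 b1 b2; split; lra.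
Qed.

Let sandwich_0 (y e : R) : s = 0 -> y != 0 -> 0 < e -> exists2 h : R, 0 < h &
  \forall n \near \oo,
    fine (P [set w | S n w <= y + h]) <= normal_cdf R (s ^+ 2) y + e /\
    normal_cdf R (s ^+ 2) y - e <= fine (P [set w | S n w <= y - h]).
Proof.
move=> s0 yN0 e0; rewrite s0 expr0n /= normal_cdf0.
(* A shift by |y|/2 leaves y on its side of the jump at 0, at distance |y|/2. The tolerance [d0]
   below makes the Chebyshev bound equal to e. *)
have h0 : 0 < `|y| / 2 by rewrite divr_gt0// normr_gt0.
exists (`|y| / 2) => //.
have d0 : 0 < e * (`|y| / 2) ^+ 2 by rewrite mulr_gt0// exprn_gt0.
have := normalized_sum_tail _ _ _ P Y s indY idY iY2 EY EY2 _ _ h0 d0.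
apply: filterS => n.
rewrite s0 expr0n /= add0r mulfK ?gt_eqF ?exprn_gt0// => tail.
have [y0|y0] := leP 0 y.
  rewrite ger0_norm//= in tail *; split.
    by rewrite (le_trans (fine_probability_le1 _ _ _ P _ (mS n _)))// lerDl ltW.
  have : fine (P (~` [set w | y / 2 <= `|S n w|])) <=
         fine (P [set w | S n w <= y - y / 2]).
    apply: fine_probability_le => //; first exact: measurableC.
    move=> w /= /negP; rewrite -ltNge => Sw; have := ler_norm (S n w); lra.
  rewrite fine_probability_setC//; lra.
rewrite ltr0_norm//= in tail *; split.
  rewrite add0r; apply: le_trans tail; apply: fine_probability_le => // w /= Sw.
  have := ler_norm (- S n w); rewrite normrN; lra.
by rewrite sub0r (le_trans _ (fine_probability_ge0 _ _ _ P _))// oppr_le0 ltW.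
Qed.

(** The margin h is what the delta method will consume: its error shifts the threshold y by at most
    h. *)
Lemma clt_sandwich (y e : R) : 0 <= s -> 0 < s \/ y != 0 -> 0 < e ->
  exists2 h : R, 0 < h & \forall n \near \oo,
    fine (P [set w | S n w <= y + h]) <= normal_cdf R (s ^+ 2) y + e /\
    normal_cdf R (s ^+ 2) y - e <= fine (P [set w | S n w <= y - h]).
Proof.
move=> s_ge0 sy e0; have [s_le0|s0] := leP s 0; last exact: (sandwich_pos y e s0 e0).
have sE0 : s = 0 by apply/eqP; rewrite eq_le s_le0.
have yN0 : y != 0 by case: sy => //; rewrite sE0 ltxx.
exact: (sandwich_0 y e sE0 yN0 e0).
Qed.

End clt_sandwich.

Section polynomial_moments.
Context d (T : measurableType d) (R : realType) (P : probability T R).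
Variable X : {RV P >-> R}.
Hypothesis iX4 : P.-integrable setT (EFin \o (fun w => X w ^+ 4)).
Local Notation m k := (\int[P]_w (X w ^+ k)).

Let mX k : measurable_fun setT (fun w => X w ^+ k).
Proof. exact: measurable_funX. Qed.

Lemma integrable_moment2 : P.-integrable setT (EFin \o (fun w => X w ^+ 2)).
Proof.
apply: integrable_sqr; first exact: mX.
by apply: eq_integrable iX4 => // w _ /=; rewrite -exprM.
Qed.

Lemma integrable_moment1 : P.-integrable setT (EFin \o X).
Proof. exact: (integrable_sqr _ _ _ P X _ integrable_moment2). Qed.

Let iX3 : P.-integrable setT (EFin \o (fun w => X w ^+ 3)).
Proof.
apply: le_integrable (integrableD measurableT integrable_moment2 iX4) => //.
  exact/measurable_EFinP.
move=> w _ /=; rewrite lee_fin [leRHS]ger0_norm ?addr_ge0 ?exprn_even_ge0//.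
rewrite exprSr normrM (ger0_norm (sqr_ge0 _)).
have -> : X w ^+ 4 = X w ^+ 2 * X w ^+ 2 by rewrite -exprD.
have := sqr_ge0 (X w); set z := X w ^+ 2 => z0.
have -> : z + z * z = z * (1 + z) by ring.
rewrite ler_wpM2l// /z -(real_normK (num_real (X w))).
have := sqr_ge0 (`|X w| - 1 / 2); rewrite !expr2; lra.
Qed.

Lemma expectation_poly4 c4 c3 c2 c1 c0 :
  P.-integrable setT (EFin \o (fun w =>
    c4 * X w ^+ 4 + (c3 * X w ^+ 3 + (c2 * X w ^+ 2 + (c1 * X w + c0))))) /\
  \int[P]_w (c4 * X w ^+ 4 + (c3 * X w ^+ 3 + (c2 * X w ^+ 2 + (c1 * X w + c0)))) =
  c4 * m 4 + (c3 * m 3 + (c2 * m 2 + (c1 * m 1 + c0))).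
Proof.
have add (f g : T -> R) c : P.-integrable setT (EFin \o f) ->
    P.-integrable setT (EFin \o g) ->
    P.-integrable setT (EFin \o (fun w => c * f w + g w)) /\
    \int[P]_w (c * f w + g w) = c * (\int[P]_w f w) + \int[P]_w g w.
  move=> fi gi; have cfi : P.-integrable setT (EFin \o (fun w => c * f w)).
    exact: (integrableZl measurableT c fi).
  split; first exact: (integrableD measurableT cfi gi).
  by rewrite RintegralD// RintegralZl.
have i0 : P.-integrable setT (EFin \o (fun=> c0)).
  exact: finite_measure_integrable_cst.
have [i1 E1] := add _ _ c1 integrable_moment1 i0.
have [i2 E2] := add _ _ c2 integrable_moment2 i1.
have [i3 E3] := add _ _ c3 iX3 i2.
have [i4 E4] := add _ _ c4 iX4 i3.
by split => //; rewrite E4 E3 E2 E1 Rintegral_probability_cst.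
Qed.

(** Almost surely X = |X|, and a zero integral of |X| would force X = 0 almost surely. *)
Lemma mean_gt0 : P [set w | 0 < X w] = 1%E -> 0 < m 1.
Proof.
move=> X0.
have mX0 : measurable [set w | 0 < X w].
  rewrite (_ : [set _ | _] = X @^-1` `]0, +oo[); first exact: measurable_funPTI.
  by apply/seteqP; split=> w /=; rewrite in_itv/= andbT.
have PC0 : P (~` [set w | 0 < X w]) = 0%E by rewrite probability_setC// X0 subee.
have mXE : measurable_fun setT (EFin \o X) by apply/measurable_EFinP.
have intE : \int[P]_w X w = fine (\int[P]_w (`|(X w)%:E|)).
  rewrite /Rintegral; congr fine; apply: ae_eq_integral => //.
    exact: measurableT_comp.
  exists (~` [set w | 0 < X w]); split => //; first exact: measurableC.
  by move=> w /= h Xw; apply: h => _; rewrite gtr0_norm.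
have -> : m 1 = \int[P]_w X w by [].
rewrite intE lt_neqAle fine_ge0 ?integral_ge0// andbT eq_sym.
apply/negP => /eqP I0.
have iabs : (\int[P]_w `|(X w)%:E|)%E = 0%E.
  rewrite -[LHS]fineK; first by rewrite I0.
  exact: integrable_fin_num (integrable_abse integrable_moment1).
have /(ae_eq_integral_abs P measurableT mXE) [N [mN N0 XN]] := iabs.
have : P [set w | 0 < X w] = 0%E.
  apply/eqP; rewrite eq_le measure_ge0 andbT -N0 le_measure ?inE//.
  move=> w /= Xw; apply: XN => /= h; have := h I => /= -[] Xw0.
  by rewrite Xw0 ltxx in Xw.
by rewrite X0 => /eqP; rewrite onee_eq0.
Qed.

End polynomial_moments.

Section quadratic_transform.
Context d (T : measurableType d) (R : realType) (P : probability T R).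

(** One form for the two variables to which the limit theorems are applied: the linearized summand
    of V_n and the centred X - m1, which controls the empirical mean. *)
Definition quadratic (a b c : R) (X : {RV P >-> R}) : T -> R :=
  fun w => a * X w ^+ 2 + (b * X w + c).

Let measurable_poly (a b c : R) :
  measurable_fun setT (fun x : R => a * x ^+ 2 + (b * x + c)).
Proof.
by apply: continuous_measurable_fun => x; apply: cvgD;
  [apply: cvgM; [exact: cvg_cst|exact: exprn_continuous]|
   apply: cvgD; [apply: cvgM; [exact: cvg_cst|exact: cvg_id]|exact: cvg_cst]].
Qed.

Let measurable_quadratic a b c (X : {RV P >-> R}) :
  measurable_fun setT (quadratic a b c X).
Proof. exact: (measurableT_comp (measurable_poly a b c)). Qed.

HB.instance Definition _ a b c (X : {RV P >-> R}) :=
  isMeasurableFun.Build _ _ _ _ (quadratic a b c X) (measurable_quadratic a b c X).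

Variables (X : nat -> {RV P >-> R}) (a b c : R).
Let Y i : {RV P >-> R} := quadratic a b c (X i).

Let mpre (A : set R) : measurable A ->
  measurable ((fun x : R => a * x ^+ 2 + (b * x + c)) @^-1` A).
Proof.
by move=> mA; rewrite -[X in measurable X]setTI; exact: measurable_poly.
Qed.

Lemma mutually_independent_quadratic :
  mutually_independent P X -> mutually_independent P Y.
Proof. by move=> iX J A mA; exact: (iX J _ (fun i => mpre _ (mA i))). Qed.

Lemma identically_distributed_quadratic :
  identically_distributed P X -> identically_distributed P Y.
Proof. by move=> iX i j A mA; exact: (iX i j _ (mpre _ mA)). Qed.

Hypothesis iX4 : P.-integrable setT (EFin \o (fun w => X 0%N w ^+ 4)).
Local Notation m k := (\int[P]_w (X 0%N w ^+ k)).

Lemma expectation_quadratic : \int[P]_w Y 0%N w = a * m 2 + (b * m 1 + c).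
Proof.
have [_] := expectation_poly4 _ _ _ P (X 0%N) iX4 0 0 a b c.
rewrite !mul0r !add0r => <-; apply: eq_Rintegral => w _.
by rewrite !mul0r !add0r.
Qed.

Let sqrE : (fun w => Y 0%N w ^+ 2) = (fun w => a ^+ 2 * X 0%N w ^+ 4 +
  (2 * a * b * X 0%N w ^+ 3 + ((b ^+ 2 + 2 * a * c) * X 0%N w ^+ 2 +
  (2 * b * c * X 0%N w + c ^+ 2)))).
Proof. by apply/funext => w; rewrite /Y /= /quadratic; ring. Qed.

Lemma integrable_quadratic_sqr :
  P.-integrable setT (EFin \o (fun w => Y 0%N w ^+ 2)).
Proof.
by rewrite sqrE; have [] := expectation_poly4 _ _ _ P (X 0%N) iX4 (a ^+ 2)
  (2 * a * b) (b ^+ 2 + 2 * a * c) (2 * b * c) (c ^+ 2).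
Qed.

Lemma expectation_quadratic_sqr : \int[P]_w (Y 0%N w ^+ 2) =
  a ^+ 2 * m 4 + (2 * a * b * m 3 + ((b ^+ 2 + 2 * a * c) * m 2 +
  (2 * b * c * m 1 + c ^+ 2))).
Proof.
by rewrite sqrE; have [] := expectation_poly4 _ _ _ P (X 0%N) iX4 (a ^+ 2)
  (2 * a * b) (b ^+ 2 + 2 * a * c) (2 * b * c) (c ^+ 2).
Qed.

Lemma normalized_sum_quadratic n w :
  normalized_sum _ _ _ P Y n w = (Num.sqrt n%:R)^-1 *
    (a * (\sum_(i < n) X i w ^+ 2) + (b * (\sum_(i < n) X i w) + c * n%:R)).
Proof.
rewrite /normalized_sum; congr (_ * _).
by rewrite 2!big_split/= -!mulr_sumr sumr_const card_ord mulr_natr.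
Qed.

End quadratic_transform.

(** * The delta method as a deterministic inequality *)

Section delta_method.
Context {R : realType} (m1 m2 q S1 S2 y h K : R).
Hypotheses (m10 : 0 < m1) (m20 : 0 <= m2) (q1 : 1 <= q) (K0 : 0 <= K).

(** Here q stands for sqrt n, [S1] and [S2] for the sums of the X_i and of their squares; [z] and
    [x] are then the normalized sums of the centred and of the linearized variables. *)
Let z := q^-1 * (S1 - m1 * q ^+ 2).
Let x := q^-1 * ((m1 ^+ 2)^-1 * S2 + (- (2 * m2 / m1 ^+ 3) * S1 + m2 / m1 ^+ 2 * q ^+ 2)).
Let V := q * (q ^+ 2 * (S2 / S1 ^+ 2) - m2 / m1 ^+ 2).
Let rho := 1 + z / (q * m1).

Hypothesis zK : `|z| < K.
Hypothesis Kq : K < m1 * q.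
Hypothesis hq : `|y| * (2 * K / m1 + K ^+ 2 / m1 ^+ 2) + m2 / m1 ^+ 4 * K ^+ 2 <= h * q.

Let q0 : 0 < q. Proof. exact: lt_le_trans q1. Qed.

Let rho0 : 0 < rho.
Proof.
have mq : 0 < q * m1 by rewrite mulr_gt0.
have : - 1 < z / (q * m1); last by rewrite /rho; lra.
rewrite ltr_pdivlMr// mulN1r; move: zK; rewrite ltr_norml => /andP[z1 _].
by move: Kq; rewrite (mulrC m1); lra.
Qed.

Let S1E : S1 = rho * (m1 * q ^+ 2).
Proof. by rewrite /rho /z; field; rewrite !gt_eqF. Qed.

(* This exact identity, [rho] being the ratio of the empirical mean to [m1], stands
   for the first-order expansion of the delta method. *)
Let VE : V * rho ^+ 2 = x - m2 / m1 ^+ 4 * (z ^+ 2 / q).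
Proof.
have S10 : S1 != 0 by rewrite S1E !mulf_neq0// ?expf_neq0// gt_eqF.
have -> : rho = S1 / (m1 * q ^+ 2) by rewrite S1E; field; rewrite !gt_eqF.
by rewrite /V /x /z; field; rewrite S10 !gt_eqF.
Qed.

(** Since rho > 0, V <= y means V rho^2 <= y rho^2, that is x <= y + r. For |z| < K and q >= 1 this
    shift is of order 1/q, and [hq] is the explicit condition for |r| <= h. *)
Let r := y * (2 * (z / (q * m1)) + z ^+ 2 / (q ^+ 2 * m1 ^+ 2)) +
  m2 / m1 ^+ 4 * (z ^+ 2 / q).

Let V_le : (V <= y) = (x <= y + r).
Proof.
rewrite -(ler_pM2r (x := rho ^+ 2)) ?exprn_gt0// VE lerBlDr; congr (_ <= _).
by rewrite /r /rho; field; rewrite !gt_eqF.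
Qed.

Let r_le : `|r| <= h.
Proof.
rewrite -(ler_pM2r q0); apply: le_trans hq.
have z2 : z ^+ 2 <= K ^+ 2.
  by rewrite -(real_normK (num_real z)) lerXn2r ?nnegrE// ltW.
rewrite -[X in _ * X](gtr0_norm q0) -normrM.
have -> : r * q = y * (2 * z / m1 + z ^+ 2 / m1 ^+ 2 * q^-1) + m2 / m1 ^+ 4 * z ^+ 2.
  by rewrite /r; field; rewrite !gt_eqF.
have v4 : 0 <= m2 / m1 ^+ 4 by rewrite divr_ge0// exprn_ge0// ltW.
rewrite (le_trans (ler_normD _ _))// lerD//; last first.
  by rewrite normrM ger0_norm// ger0_norm ?sqr_ge0// ler_wpM2l.
rewrite normrM ler_wpM2l// (le_trans (ler_normD _ _))// lerD//.
  rewrite (normrM (2 * z)) (normrM 2 z) (normfV m1) (gtr0_norm m10) (@ger0_norm _ 2)//.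
  by rewrite ler_wpM2r ?invr_ge0 ?(ltW m10)// ler_wpM2l// ltW.
rewrite ger0_norm; last first.
  by apply: mulr_ge0; [apply: divr_ge0; exact: sqr_ge0|rewrite invr_ge0 ltW].
apply: (@le_trans _ _ (z ^+ 2 / m1 ^+ 2)).
  by rewrite ler_piMr ?divr_ge0 ?sqr_ge0// invf_le1.
by rewrite ler_wpM2r ?invr_ge0 ?sqr_ge0.
Qed.

Lemma delta_method : (V <= y -> x <= y + h) /\ (x <= y - h -> V <= y).
Proof.
by rewrite V_le; move: r_le; rewrite ler_norml => /andP[r1 r2]; split; lra.
Qed.

End delta_method.

Lemma measurable_invr (R : realType) : measurable_fun [set: R] (@GRing.inv R).
Proof.
have D0 : measurable (~` [set 0 : R]) by exact: measurableC.
rewrite -(setvU [set 0 : R]); apply/measurable_funU => //.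
split; last exact: measurable_fun_set1.
apply: open_continuous_measurable_fun; first exact: closed_openC (@closed_eq _ 0).
by move=> x; rewrite inE => /eqP; exact: inv_continuous.
Qed.

(** The measurable structure on [T] is a parameter: besides the ambient one, the lemma is applied to
    the sigma-algebra generated by the X_i, to place the events V_n <= y in it. *)
Lemma measurable_self_normalized_sum d (T : measurableType d) (R : realType)
    (X : nat -> T -> R) (n : nat) (c : R) :
  (forall i, measurable_fun setT (X i)) ->
  measurable_fun setT (fun w => Num.sqrt n%:R *
    (n%:R * ((\sum_(i < n) X i w ^+ 2) / (\sum_(i < n) X i w) ^+ 2) - c)).
Proof.
move=> mX; apply: measurable_funM; first exact: measurable_cst.
apply: measurable_funB; last exact: measurable_cst.
apply: measurable_funM; first exact: measurable_cst.
apply: measurable_funM.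
  by apply: measurable_sum => i; exact: measurable_funX.
apply: (measurableT_comp (measurable_invr R)); apply: measurable_funX.
by apply: measurable_sum => i; exact: mX.
Qed.

Section self_normalized_sum.
Context d (T : measurableType d) (R : realType) (P : probability T R).
Variable X : nat -> {RV P >-> R}.
Hypothesis indX : mutually_independent P X.
Hypothesis idX : identically_distributed P X.
Hypothesis X0 : P [set w | 0 < X 0%N w] = 1%E.
Hypothesis iX4 : P.-integrable setT (EFin \o (fun w => X 0%N w ^+ 4)).
Local Notation m k := (\int[P]_w (X 0%N w ^+ k)).
Let sigma2 : R := m 4 / m 1 ^+ 4 - (m 2 / m 1 ^+ 2) ^+ 2
  + 4 * (m 2 / m 1 ^+ 2) ^+ 3 - 4 * m 2 * m 3 / m 1 ^+ 5.

Definition self_normalized n w : R := Num.sqrt n%:R *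
  (n%:R * ((\sum_(i < n) X i w ^+ 2) / (\sum_(i < n) X i w) ^+ 2) - m 2 / m 1 ^+ 2).

Let m10 : 0 < m 1. Proof. exact: mean_gt0. Qed.

Let m20 : 0 <= m 2. Proof. by apply: Rintegral_ge0 => w _; rewrite sqr_ge0. Qed.

Let W i : {RV P >-> R} :=
  quadratic _ _ _ P (m 1 ^+ 2)^-1 (- (2 * m 2 / m 1 ^+ 3)) (m 2 / m 1 ^+ 2) (X i).
Let Z i : {RV P >-> R} := quadratic _ _ _ P 0 1 (- m 1) (X i).

Let EW : \int[P]_w W 0%N w = 0.
Proof. by rewrite expectation_quadratic//; field; rewrite gt_eqF. Qed.

Let EW2 : \int[P]_w (W 0%N w ^+ 2) = sigma2.
Proof. by rewrite expectation_quadratic_sqr// /sigma2; field; rewrite gt_eqF. Qed.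

Let EZ : \int[P]_w Z 0%N w = 0.
Proof. by rewrite expectation_quadratic//; ring. Qed.

Lemma sigma2_ge0 : 0 <= sigma2.
Proof. by rewrite -EW2; apply: Rintegral_ge0 => w _; rewrite sqr_ge0. Qed.

Lemma measurable_self_normalized n : measurable_fun setT (self_normalized n).
Proof.
exact: (measurable_self_normalized_sum _ _ _ (fun i => X i : T -> R) _ _
  (fun i => measurable_funPT (X i))).
Qed.

(** Where the normalized sum of the X_i - m1 is below [K], the delta method compares V_n with the
    sum of the [W i]; elsewhere the tail bound applies. *)
Lemma cvg_self_normalized (y : R) : 0 < sigma2 \/ y != 0 ->
  fine (P [set w | self_normalized n w <= y]) @[n --> \oo] --> normal_cdf R sigma2 y.
Proof.
move=> sy; pose s := Num.sqrt sigma2; pose sZ := Num.sqrt (\int[P]_w (Z 0%N w ^+ 2)).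
have s2 : s ^+ 2 = sigma2 by rewrite sqr_sqrtr// sigma2_ge0.
have sZ2 : \int[P]_w (Z 0%N w ^+ 2) = sZ ^+ 2.
  by rewrite sqr_sqrtr//; apply: Rintegral_ge0 => w _; rewrite sqr_ge0.
have indW := mutually_independent_quadratic _ _ _ P X (m 1 ^+ 2)^-1
  (- (2 * m 2 / m 1 ^+ 3)) (m 2 / m 1 ^+ 2) indX.
have idW := identically_distributed_quadratic _ _ _ P X (m 1 ^+ 2)^-1
  (- (2 * m 2 / m 1 ^+ 3)) (m 2 / m 1 ^+ 2) idX.
have indZ := mutually_independent_quadratic _ _ _ P X 0 1 (- m 1) indX.
have idZ := identically_distributed_quadratic _ _ _ P X 0 1 (- m 1) idX.
have iW2 := integrable_quadratic_sqr _ _ _ P X (m 1 ^+ 2)^-1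
  (- (2 * m 2 / m 1 ^+ 3)) (m 2 / m 1 ^+ 2) iX4.
have iZ2 := integrable_quadratic_sqr _ _ _ P X 0 1 (- m 1) iX4.
rewrite -s2; apply/cvgrPdist_le => e e0.
have e20 : 0 < e / 2 by rewrite divr_gt0.
have sy' : 0 < s \/ y != 0 by case: sy => ?; [left; rewrite sqrtr_gt0|right].
have EW2' : \int[P]_w (W 0%N w ^+ 2) = s ^+ 2 by rewrite EW2.
have [h h0 sandwich] := clt_sandwich _ _ _ P W s indW idW iW2 EW EW2' y (e / 2)
  (sqrtr_ge0 _) sy' e20.
(* Solves (sZ^2 + 1)/K^2 = e/2, the tail bound taken with tolerance 1 on the second moment. *)
pose K := Num.sqrt (2 * (sZ ^+ 2 + 1) / e).
have K20 : 0 < 2 * (sZ ^+ 2 + 1) / e.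
  by rewrite divr_gt0// mulr_gt0// ltr_wpDl// sqr_ge0.
have K0 : 0 < K by rewrite sqrtr_gt0.
have tail := normalized_sum_tail _ _ _ P Z sZ indZ idZ iZ2 EZ sZ2 K 1 K0 ltr01.
pose C := `|y| * (2 * K / m 1 + K ^+ 2 / m 1 ^+ 2) + m 2 / m 1 ^+ 4 * K ^+ 2.
(* The three entries are the lower bounds that the hypotheses of [delta_method] put on sqrt n. *)
pose B := Num.max 1 (Num.max (K / m 1) (C / h)).
have B0 : 0 <= B by rewrite le_max ler01.
near=> n.
have Bn : B < Num.sqrt n%:R.
  rewrite -[ltLHS]ger0_norm// -sqrtr_sqr ltr_sqrt//; last first.
    by rewrite ltr0n; near: n; exact: nbhs_infty_gt.
  by near: n; exact: nbhs_infty_gtr.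
have [W1 W2] : fine (P [set w | normalized_sum _ _ _ P W n w <= y + h]) <=
      normal_cdf R (s ^+ 2) y + e / 2 /\
    normal_cdf R (s ^+ 2) y - e / 2 <=
      fine (P [set w | normalized_sum _ _ _ P W n w <= y - h]).
  by near: n; exact: sandwich.
have Zt : fine (P [set w | K <= `|normalized_sum _ _ _ P Z n w|]) <= e / 2.
  have <- : (sZ ^+ 2 + 1) / K ^+ 2 = e / 2.
    have v0 : 0 < sZ ^+ 2 + 1 by rewrite ltr_wpDl// sqr_ge0.
    rewrite (sqr_sqrtr (ltW K20)); move: v0; set v := _ + 1 => v0.
    by field; rewrite !gt_eqF.
  by near: n; exact: tail.
have mV x : measurable [set w | self_normalized n w <= x].
  rewrite -[X in measurable X]setTI; apply: measurable_fun_le => //.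
  exact: measurable_self_normalized.
have mWn x : measurable [set w | normalized_sum _ _ _ P W n w <= x].
  rewrite -[X in measurable X]setTI; apply: measurable_fun_le => //.
  exact: measurable_normalized_sum.
have mZn : measurable [set w | K <= `|normalized_sum _ _ _ P Z n w|].
  rewrite -[X in measurable X]setTI; apply: measurable_fun_le => //.
  by apply: measurableT_comp => //; exact: measurable_normalized_sum.
have key w : `|normalized_sum _ _ _ P Z n w| < K ->
    (self_normalized n w <= y -> normalized_sum _ _ _ P W n w <= y + h) /\
    (normalized_sum _ _ _ P W n w <= y - h -> self_normalized n w <= y).
  have qn : Num.sqrt n%:R ^+ 2 = n%:R :> R by rewrite sqr_sqrtr.
  move: Bn; rewrite !gt_max => /andP[q1 /andP[qK qC]].
  have D := delta_method (m 1) (m 2) (Num.sqrt n%:R) (\sum_(i < n) X i w)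
    (\sum_(i < n) X i w ^+ 2) y h K m10 m20 (ltW q1) (ltW K0).
  rewrite qn in D; rewrite !normalized_sum_quadratic mul0r add0r mul1r mulNr => zK.
  apply: D => //.
  - by rewrite mulrC -ltr_pdivrMr.
  - by rewrite [leRHS]mulrC -ler_pdivrMr// ltW.
rewrite ler_norml; apply/andP; split.
- have : fine (P [set w | self_normalized n w <= y]) <=
      fine (P [set w | normalized_sum _ _ _ P W n w <= y + h]) +
      fine (P [set w | K <= `|normalized_sum _ _ _ P Z n w|]).
    apply: fine_probability_leU => // w /= Vw.
    by have [?|/key[H _]] := leP K `|normalized_sum _ _ _ P Z n w|; [right|left; apply: H].
  lra.
- have : fine (P [set w | normalized_sum _ _ _ P W n w <= y - h]) <=
      fine (P [set w | self_normalized n w <= y]) +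
      fine (P [set w | K <= `|normalized_sum _ _ _ P Z n w|]).
    apply: fine_probability_leU => // w /= Ww.
    by have [?|/key[_ H]] := leP K `|normalized_sum _ _ _ P Z n w|; [right|left; apply: H].
  lra.
Unshelve. all: by end_near. Qed.

End self_normalized_sum.

(** * Random time change *)

Section cdf_continuity_points.
Context d (T : measurableType d) (R : realType) (P : probability T R).
Variable L : {RV P >-> R}.

(** Only left continuity is at stake: the probabilities that s - 1/(n+1) < L <= s decrease to that
    of L = s, which is 0. *)
Lemma continuous_cdf (s : R) : pmf L s = 0 -> {for s, continuous (cdf L)}.
Proof.
move=> Ls.
have fine_cdf x : cdf L x = (fine (cdf L x))%:E by rewrite fineK// fin_num_measure.
apply/left_right_continuousP; split; last exact: cdf_right_continuous.
rewrite [X in _ --> X]fine_cdf; apply/fine_cvgP; split.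
  by apply: nearW => x; rewrite fin_num_measure.
pose F n := L @^-1` `]s - n.+1%:R^-1, s].
have mF n : measurable (F n) by exact: measurable_funPTI.
have cvF : P (F n) @[n --> \oo] --> (0 : R)%:E.
  have -> : (0 : R)%:E = P (\bigcap_n F n).
    have -> : \bigcap_n F n = L @^-1` [set s].
      apply/seteqP; split => [w Fw|w /= Lw n _]; last first.
        by rewrite /F /= Lw in_itv/= lexx andbT ltrBlDr ltrDl.
      have := Fw 0%N I; rewrite /F/= in_itv/= => /andP[_].
      rewrite le_eqVlt => /predU1P[//|/ltr_add_invr[k Lk]].
      have := Fw k I; rewrite /F/= in_itv/= ltrBlDr => /andP[+ _].
      by move=> /(lt_trans Lk); rewrite ltxx.
    by rewrite -Ls /pmf fineK// fin_num_measure//; exact: measurable_funPTI.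
  apply: nonincreasing_cvg_mu => //.
  - by rewrite (le_lt_trans (probability_le1 _ _)) ?ltry.
  - exact: bigcap_measurableType.
  - move=> n k nk; apply/subsetPset => w; rewrite /F/= !in_itv/= => /andP[Lw ->].
    rewrite andbT (le_lt_trans _ Lw)// lerD2l lerN2.
    by rewrite lef_pV2 ?posrE// ler_nat.
apply/cvgrPdist_le => e e0.
have /fine_cvgP[_ /cvgrPdist_le/(_ _ e0)] := cvF.
move=> /filter_ex[n]; rewrite sub0r normrN ger0_norm ?fine_ge0//= => Fn.
near=> x.
have xs : x <= s by [].
have sx : s - n.+1%:R^-1 <= x.
  by near: x; apply: nbhs_left_ge; rewrite ltrBlDr ltrDl.
rewrite ger0_norm; last first.
  by rewrite subr_ge0 fine_le ?fin_num_measure// cdf_nondecreasing.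
rewrite /= lerBlDl (le_trans _ (lerD (lexx _) Fn))//.
apply: (fine_probability_leU _ _ _ P); [exact: measurable_funPTI..|].
move=> w; rewrite /F/= !in_itv/= => Lw.
have [?|xL] := leP (L w) x; [by left|right].
by rewrite Lw andbT (le_lt_trans sx).
Unshelve. all: by end_near. Qed.

(** The atoms of a law are countable, hence Lebesgue null, while the interval has positive
    length. *)
Lemma continuity_point_between (u v : R) : u < v ->
  exists2 s, u < s < v & pmf L s = 0.
Proof.
move=> uv; apply/not_exists2P => H.
have : lebesgue_measure (`]u, v[%classic : set R) = 0%E.
  apply: (subset_measure0 (mu := lebesgue_measure) (B := [set s | 0 < pmf L s])) => //.
  - by apply: countable_measurable => //; exact: pmf_gt0_countable.
  - move=> s /=; rewrite in_itv/= => us; have [//|Ls] := H s.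
    by rewrite lt_neqAle pmf_ge0 andbT eq_sym; apply/eqP.
  - by apply: countable_lebesgue_measure0; exact: pmf_gt0_countable.
rewrite lebesgue_measure_itv/= lte_fin uv -EFinB => -[] /eqP.
by rewrite subr_eq0 gt_eqF.
Qed.

End cdf_continuity_points.

Section random_index.
Context d (T : measurableType d) (R : realType) (P : probability T R).
Variables (N : {RV P >-> nat}) (D : nat -> set T) (A : set nat).
Hypothesis mD : forall n, measurable (D n).
Hypothesis ND : forall n,
  P (N @^-1` [set n] `&` D n) = (P (N @^-1` [set n]) * P (D n))%E.

Let mN n : measurable (N @^-1` [set n]).
Proof. by rewrite -[X in measurable X]setTI; exact: measurable_funPT. Qed.

Lemma random_index_le (h : R) : (forall n, A n -> fine (P (D n)) <= h) -> 0 <= h ->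
  fine (P [set w | A (N w) /\ D (N w) w]) <= h * fine (P (N @^-1` A)).
Proof.
move=> Dh h0; rewrite -lee_fin EFinM.
have mND n : measurable (N @^-1` [set n] `&` D n) by exact: measurableI.
have E1 : [set w | A (N w) /\ D (N w) w] = \bigcup_(n in A) (N @^-1` [set n] `&` D n).
  by apply/seteqP; split => [w [AN DN]|w [n An [/= Nn Dn]]];
    [exists (N w)|rewrite Nn].
have E2 : N @^-1` A = \bigcup_(n in A) (N @^-1` [set n]).
  by apply/seteqP; split => [w AN|w [n An /= Nn]]; [exists (N w)|rewrite /= Nn].
have t2 : trivIset A (fun n => N @^-1` [set n]).
  by move=> i j _ _ [w [/= -> ->]].
have t1 : trivIset A (fun n => N @^-1` [set n] `&` D n).
  by move=> i j _ _ [w [[/= -> _] [-> _]]].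
have m1 : measurable [set w | A (N w) /\ D (N w) w].
  by rewrite E1; exact: bigcup_measurable.
have m2 : measurable (N @^-1` A) by rewrite E2; exact: bigcup_measurable.
rewrite !fineK ?fin_num_measure// E1 E2 !measure_bigcup// -nneseriesZl//.
apply: lee_nneseries => // n; rewrite inE => An.
rewrite [X in (X <= _)%E](ND n) muleC lee_wpmul2r// -[leLHS]fineK ?fin_num_measure// lee_fin.
exact: Dh.
Qed.

End random_index.

(** The upper bound sums over the values of [N]; the lower bound is the upper bound for the
    complements of the [D n], with 1 - l >= 0 in place of h. *)
Lemma random_index_bounds d (T : measurableType d) (R : realType)
    (P : probability T R) (N : {RV P >-> nat}) (D : nat -> set T) (A : set nat)
    (l h : R) :
  (forall n, measurable (D n)) ->
  (forall n, P (N @^-1` [set n] `&` D n) = (P (N @^-1` [set n]) * P (D n))%E) ->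
  (forall n, A n -> l <= fine (P (D n)) <= h) -> l <= 1 -> 0 <= h ->
  l * fine (P (N @^-1` A)) <= fine (P [set w | A (N w) /\ D (N w) w])
    <= h * fine (P (N @^-1` A)).
Proof.
move=> mD ND Dlh l1 h0; apply/andP; split; last first.
  by apply: random_index_le => // n /Dlh/andP[].
have mN n : measurable (N @^-1` [set n]).
  by rewrite -[X in measurable X]setTI; exact: measurable_funPT.
have mA (B : set nat) : measurable (N @^-1` B).
  by rewrite -[X in measurable X]setTI; exact: measurable_funPT.
have mAD (C : nat -> set T) : (forall n, measurable (C n)) ->
    measurable [set w | A (N w) /\ C (N w) w].
  move=> mC; rewrite (_ : [set _ | _] = \bigcup_(n in A) (N @^-1` [set n] `&` C n)).
    by apply: bigcup_measurable => n _; exact: measurableI.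
  by apply/seteqP; split => [w [AN DN]|w [n An [/= Nn Dn]]];
    [exists (N w)|rewrite Nn].
have : fine (P [set w | A (N w) /\ (~` D (N w)) w]) <=
    (1 - l) * fine (P (N @^-1` A)).
  apply: (random_index_le _ _ _ P N (fun n => ~` D n)) => [n|n|n An|].
  - exact: measurableC.
  - rewrite -setDE measureD//; last by rewrite (le_lt_trans (probability_le1 _ _)) ?ltry.
    by rewrite [X in (_ - X)%E](ND n) probability_setC// muleBr ?mule1// fin_num_measure.
  - by rewrite fine_probability_setC// lerD2l lerN2; have /andP[] := Dlh n An.
  - by rewrite subr_ge0.
have mDC := mAD (fun n => ~` D n) (fun n => measurableC (mD n)).
have -> : fine (P (N @^-1` A)) =
    fine (P [set w | A (N w) /\ D (N w) w]) + fine (P [set w | A (N w) /\ (~` D (N w)) w]).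
  rewrite -fineD; [|exact: (fin_num_measure P _ (mAD D mD))|exact: (fin_num_measure P _ mDC)].
  rewrite -(measureU P (mAD D mD) mDC).
    congr (fine (P _)); apply/seteqP; split => [w /= AN|w [[]|[]]//].
    by have [Dw|Dw] := pselect (D (N w) w); [left|right].
  by apply/seteqP; split => [w /= [[_ Dw] [_ nDw]]|//]; exact: nDw.
set p := fine (P [set w | A (N w) /\ D (N w) w]); lra.
Qed.

Section probability_cells.
Context d (T : measurableType d) (R : realType) (P : probability T R).
Implicit Types A B C : set T.

Lemma fine_probabilityU A B : measurable A -> measurable B -> A `&` B = set0 ->
  fine (P (A `|` B)) = fine (P A) + fine (P B).
Proof.
by move=> mA mB AB; rewrite (measureU P mA mB AB) fineD; [|exact: fin_num_measure..].
Qed.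

Variable Y : T -> R.
Hypothesis mY : measurable_fun setT Y.

Lemma measurable_le_fun (b : R) : measurable [set w | Y w <= b].
Proof. by rewrite -[X in measurable X]setTI; exact: measurable_fun_le. Qed.

Lemma measurable_cell (a b : R) : measurable [set w | a < Y w <= b].
Proof.
rewrite (_ : [set _ | _] = [set w | Y w <= b] `\` [set w | Y w <= a]).
  by apply: measurableD; exact: measurable_le_fun.
apply/seteqP; split => w /=; first by move=> /andP[aY Yb]; split => //; rewrite leNgt aY.
by move=> [Yb /negP]; rewrite -ltNge => aY; rewrite aY.
Qed.

Lemma fine_probability_cell (a b : R) : a <= b ->
  fine (P [set w | a < Y w <= b]) = fine (P [set w | Y w <= b]) - fine (P [set w | Y w <= a]).
Proof.
move=> ab; apply/eqP; rewrite eq_sym subr_eq; apply/eqP.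
rewrite -fine_probabilityU; [|exact: measurable_cell|exact: measurable_le_fun|].
  congr (fine (P _)); apply/seteqP; split => w /=.
    by move=> Yb; have [Ya|aY] := leP (Y w) a; [right|left].
  by move=> [/andP[]//|/le_trans]; apply.
by apply/seteqP; split => w //= [/andP[aY _]]; rewrite leNgt aY.
Qed.

Lemma fine_probability_cellI A (a b c : R) : measurable A -> a <= b -> b <= c ->
  fine (P (A `&` [set w | a < Y w <= c])) =
  fine (P (A `&` [set w | a < Y w <= b])) + fine (P (A `&` [set w | b < Y w <= c])).
Proof.
move=> mA ab bc; rewrite -fine_probabilityU.
- congr (fine (P _)); apply/seteqP; split => w /=.
    move=> [Aw /andP[aY Yc]]; have [Yb|bY] := leP (Y w) b; [left|right];
      by split => //=; rewrite ?aY ?bY.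
  move=> [[Aw /andP[aY Yb]]|[Aw /andP[bY Yc]]]; split => //.
    by rewrite aY (le_trans Yb).
  by rewrite Yc andbT (le_lt_trans ab).
- by apply: measurableI => //; exact: measurable_cell.
- by apply: measurableI => //; exact: measurable_cell.
- apply/seteqP; split => w //= [[_ /andP[_ Yb]] [_ /andP[bY _]]].
  by have := lt_le_trans bY Yb; rewrite ltxx.
Qed.

Lemma fine_probability_outside A (a b : R) : measurable A -> a <= b ->
  `|fine (P A) - fine (P (A `&` [set w | a < Y w <= b]))| <=
  fine (P [set w | Y w <= a]) + (1 - fine (P [set w | Y w <= b])).
Proof.
move=> mA ab; have mc := measurable_cell a b; have ml := measurable_le_fun.
have mg : measurable (~` [set w | Y w <= b]) by exact: measurableC.
rewrite -fine_probability_setC// ger0_norm; last first.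
  by rewrite subr_ge0 fine_probability_le//; exact: measurableI.
rewrite lerBlDl.
have : fine (P A) <= fine (P (A `&` [set w | a < Y w <= b])) +
    fine (P ([set w | Y w <= a] `|` ~` [set w | Y w <= b])).
  apply: fine_probability_leU => //; [exact: measurableI|exact: measurableU|].
  move=> w Aw; have [Ya|aY] := leP (Y w) a; first by right; left.
  have [Yb|bY] := leP (Y w) b; first by left; split => //=; rewrite aY.
  by right; right => /=; apply/negP; rewrite -ltNge.
move=> /le_trans; apply; rewrite lerD2l.
by apply: fine_probability_leU => //; exact: measurableU.
Qed.

End probability_cells.

Section random_time_limit.
Context d d' (T : measurableType d) (T' : measurableType d') (R : realType).
Variables (P : probability T R) (P' : probability T' R).
Variables (N : R -> {RV P >-> nat}) (V : nat -> T -> R) (E : R -> set T).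
Variables (Z L : {RV P' >-> R}) (E' : set T') (x : R).
Local Notation F y := (fine (P' [set w | Z w <= y])).
Local Notation ratio t := (fun w => (N t w)%:R / t).

Hypothesis mV : forall n, measurable_fun setT (V n).
Hypotheses (mE : forall t, measurable (E t)) (mE' : measurable E').
Hypothesis NV : forall (t : R) n y, 0 <= t ->
  P (N t @^-1` [set n] `&` [set w | V n w <= y]) =
  (P (N t @^-1` [set n]) * P [set w | (V n w <= y)%R])%E.
Hypothesis ZL : forall y B, measurable B ->
  P' ([set w | Z w <= y] `&` L @^-1` B) = (P' [set w | (Z w <= y)%R] * P' (L @^-1` B))%E.
Hypothesis EV : forall (t : R) w, 0 < t -> (0 < N t w)%N ->
  E t w <-> V (N t w) w <= x * Num.sqrt ((N t w)%:R / t).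
Hypothesis E'Z : forall w, 0 < L w -> E' w <-> Z w <= x * Num.sqrt (L w).
Hypothesis cvgV : forall s : R, 0 < s ->
  fine (P [set w | V n w <= x * Num.sqrt s]) @[n --> \oo] --> F (x * Num.sqrt s).
Hypothesis cvgN : forall s, pmf L s = 0 ->
  fine (P [set w | (N t w)%:R / t <= s]) @[t --> +oo] --> fine (P' [set w | L w <= s]).
Hypothesis Fmesh : forall e : R, 0 < e -> exists2 r : R, 0 < r &
  forall a b, 0 < a -> a <= b -> b < a + r ->
  `|F (x * Num.sqrt b) - F (x * Num.sqrt a)| <= e.
Hypothesis L0 : P' [set w | L w <= 0] = 0%E.

Let mratio t : measurable_fun setT (ratio t).
Proof.
apply: measurable_funM; last exact: measurable_cst.
exact: (measurable_funPT (real_of_count (N t) : {RV P >-> R})).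
Qed.

Let mL : measurable_fun setT L. Proof. exact: measurable_funPT. Qed.

Let cellN t a b := [set w | a < (N t w)%:R / t <= b].
Let cellL a b := [set w | a < L w <= b].

Let mcellN t a b : measurable (cellN t a b).
Proof. exact: (measurable_cell _ _ _ (ratio t) (mratio t)). Qed.

Let mcellL a b : measurable (cellL a b).
Proof. exact: (measurable_cell _ _ _ L mL). Qed.

Let cvg_cell a b e : a <= b -> pmf L a = 0 -> pmf L b = 0 -> 0 < e ->
  \forall t \near +oo, `|fine (P (cellN t a b)) - fine (P' (cellL a b))| <= e.
Proof.
move=> ab La Lb e0; have e20 : 0 < e / 2 by rewrite divr_gt0.
have /cvgrPdist_le/(_ _ e20) := cvgN _ La.
have /cvgrPdist_le/(_ _ e20) := cvgN _ Lb.
apply: filterS2 => t; rewrite /cellN /cellL.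
rewrite (fine_probability_cell _ _ _ P (ratio t) (mratio t))//.
rewrite (fine_probability_cell _ _ _ P' L mL)//.
rewrite !ler_norml => /andP[b1 b2] /andP[a1 a2]; apply/andP.
by split; lra.
Qed.

(** The error has a part proportional to the probability of the cell, which adds up to at most e
    over disjoint cells, and a part h, arbitrarily small for large t, which can be shared among
    finitely many cells. *)
Definition cell_close (e a b : R) := forall h : R, 0 < h -> \forall t \near +oo,
  `|fine (P (E t `&` cellN t a b)) - fine (P' (E' `&` cellL a b))| <=
  e * fine (P' (cellL a b)) + h.

Let cell_close_trans e a b c : a <= b -> b <= c ->
  cell_close e a b -> cell_close e b c -> cell_close e a c.
Proof.
move=> ab bc Cab Cbc h h0; have h20 : 0 < h / 2 by rewrite divr_gt0.
have := Cbc _ h20; have := Cab _ h20.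
apply: filterS2 => t; rewrite /cellN /cellL.
rewrite (fine_probability_cellI _ _ _ P (ratio t) (mratio t) (E t) a b c)//.
rewrite (fine_probability_cellI _ _ _ P' L mL E' a b c)//.
have := fine_probability_cellI _ _ _ P' L mL setT a b c measurableT ab bc.
rewrite !setTI => ->.
set p1 := fine (P _); set p2 := fine (P _).
set q1 := fine (P' _); set q2 := fine (P' (E' `&` [set w | b < L w <= c])).
set r1 := fine (P' [set w | a < L w <= b]); set r2 := fine (P' _).
rewrite !ler_norml => /andP[h1 h2] /andP[h3 h4]; rewrite mulrDr; apply/andP.
by split; lra.
Qed.

Let q_le1 (A : set T') : measurable A -> fine (P' A) <= 1.
Proof. exact: fine_probability_le1. Qed.

Let mZ y : measurable [set w | Z w <= y].
Proof. by apply: measurable_le_fun; exact: measurable_funPT. Qed.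

Let F_ge0 y : 0 <= F y. Proof. exact: fine_ge0. Qed.

Let F_le1 y : F y <= 1. Proof. exact: q_le1. Qed.

Let F_cell y a b : fine (P' ([set w | Z w <= y] `&` cellL a b)) = F y * fine (P' (cellL a b)).
Proof.
have -> : cellL a b = L @^-1` `]a, b].
  by apply/seteqP; split => w /=; rewrite in_itv.
rewrite ZL// fineM//; apply: fin_num_measure => //; exact: measurable_funPTI.
Qed.

Let local_close e a b : 0 < a -> a < b -> pmf L a = 0 -> pmf L b = 0 ->
  `|F (x * Num.sqrt b) - F (x * Num.sqrt a)| <= e -> cell_close e a b.
Proof.
move=> a0 ab La Lb Fe h h0; have h20 : 0 < h / 2 by rewrite divr_gt0.
have b0 := lt_trans a0 ab.
(* [sl] and [sh] are the endpoints at which x sqrt s is least and greatest: a and b for x >= 0,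
   exchanged for x < 0. *)
have [sl [sh [sl0 sh0 mono Flh]]] : exists sl sh, [/\ 0 < sl, 0 < sh,
    (forall s, a <= s <= b -> x * Num.sqrt sl <= x * Num.sqrt s <= x * Num.sqrt sh) &
    F (x * Num.sqrt sh) - F (x * Num.sqrt sl) <= e].
  have [x0|x0] := leP 0 x.
    exists a, b; split => //; last exact: le_trans (ler_norm _) Fe.
    move=> s /andP[sa sb]; apply/andP; split;
      by rewrite ler_wpM2l// ler_wsqrtr.
  exists b, a; split => //; last first.
    by rewrite distrC in Fe; exact: le_trans (ler_norm _) Fe.
  move=> s /andP[sa sb]; apply/andP; split;
    by rewrite ler_wnM2l ?ler_wsqrtr// ltW.
set yl := x * Num.sqrt sl in mono Flh *; set yh := x * Num.sqrt sh in mono Flh *.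
have /cvgrPdist_le/(_ _ h20)[n1 _ Vl] := cvgV _ sl0.
have /cvgrPdist_le/(_ _ h20)[n2 _ Vh] := cvgV _ sh0.
have cc := cvg_cell a b _ (ltW ab) La Lb h20.
near=> t.
have t0 : 0 < t by near: t; apply: nbhs_pinfty_gt; exact: num_real.
(* On the cell N > a t, so N is positive and beyond both ranks from which V_N is close to its limit.
   This is where a > 0 matters. *)
have tn : (maxn n1 n2)%:R / a < t by near: t; apply: nbhs_pinfty_gt; exact: num_real.
pose A := [set n : nat | a < n%:R / t <= b].
have An n : A n -> [/\ (0 < n)%N, (n1 <= n)%N & (n2 <= n)%N].
  move=> /andP[an _].
  have : (maxn n1 n2)%:R < n%:R :> R.
    by rewrite ltr_pdivrMr// in tn; rewrite (lt_trans tn)// mulrC -ltr_pdivlMr.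
  rewrite ltr_nat gtn_max => /andP[n1n n2n].
  by split; [exact: leq_ltn_trans n1n| exact: ltnW| exact: ltnW].
have mD y n : measurable [set w | V n w <= y] by exact: measurable_le_fun.
have ND y n : P (N t @^-1` [set n] `&` [set w | V n w <= y]) =
    (P (N t @^-1` [set n]) * P [set w | (V n w <= y)%R])%E by exact/NV/ltW.
have mAD y : measurable [set w | A (N t w) /\ V (N t w) w <= y].
  rewrite (_ : [set _ | _] =
      \bigcup_(n in A) (N t @^-1` [set n] `&` [set w | V n w <= y])).
    apply: bigcup_measurable => n _; apply: measurableI => //.
    by rewrite -[X in measurable X]setTI; exact: measurable_funPT.
  by apply/seteqP; split => [w [AN DN]|w [n An' [/= Nn Dn]]];
    [exists (N t w)|rewrite Nn].
have pq : `|fine (P (cellN t a b)) - fine (P' (cellL a b))| <= h / 2.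
  by near: t; exact: cc.
pose p := fine (P (cellN t a b)); pose q := fine (P' (cellL a b)).
rewrite -/p -/q in pq.
have p0 : 0 <= p by exact: fine_ge0.
have q0 : 0 <= q by exact: fine_ge0.
have p1 : p <= 1 by exact: fine_probability_le1.
have up : fine (P (E t `&` cellN t a b)) <= (F yh + h / 2) * p.
  have := random_index_bounds _ _ _ P (N t) (fun n => [set w | V n w <= yh]) A
    0 (F yh + h / 2) (mD yh) (ND yh).
  have H n : A n -> 0 <= fine (P [set w | V n w <= yh]) <= F yh + h / 2.
    move=> /An[_ _ n2n]; rewrite fine_ge0//=.
    by have := Vh n n2n; rewrite /= ler_norml => /andP[]; rewrite -/yh; lra.
  move=> /(_ H ler01) => /(_ (addr_ge0 (F_ge0 _) (ltW h20)))/andP[_].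
  apply: le_trans; apply: fine_probability_le;
    [exact: measurableI|exact: (mAD yh)|].
  move=> w [Ew cw]; split => //; have [N0 _ _] := An _ cw.
  move/(EV _ _ t0 N0) : Ew => /le_trans; apply.
  move: cw => /andP[c1 c2].
  by have /andP[] := mono ((N t w)%:R / t) (introT andP (conj (ltW c1) c2)).
have lo : (F yl - h / 2) * p <= fine (P (E t `&` cellN t a b)).
  have := random_index_bounds _ _ _ P (N t) (fun n => [set w | V n w <= yl]) A
    (F yl - h / 2) 1 (mD yl) (ND yl).
  have H n : A n -> F yl - h / 2 <= fine (P [set w | V n w <= yl]) <= 1.
    move=> /An[_ n1n _]; rewrite fine_probability_le1// andbT.
    by have := Vl n n1n; rewrite /= ler_norml => /andP[]; rewrite -/yl; lra.
  have F1 : F yl - h / 2 <= 1 by have := F_le1 yl; lra.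
  move=> /(_ H F1 ler01)/andP[+ _].
  move=> /le_trans; apply; apply: fine_probability_le;
    [exact: (mAD yl)|exact: measurableI|].
  move=> w [cw Vw]; split => //; have [N0 _ _] := An _ cw.
  apply/(EV _ _ t0 N0); apply: (le_trans Vw).
  move: cw => /andP[c1 c2].
  by have /andP[] := mono ((N t w)%:R / t) (introT andP (conj (ltW c1) c2)).
have up' : fine (P' (E' `&` cellL a b)) <= F yh * q.
  rewrite -F_cell; apply: fine_probability_le; [exact: measurableI..|].
  move=> w [E'w /andP[aL Lb']]; split => //; last by rewrite /cellL/= aL.
  move/(E'Z _ (lt_trans a0 aL)) : E'w => /le_trans; apply.
  by have /andP[] := mono (L w) (introT andP (conj (ltW aL) Lb')).
have lo' : F yl * q <= fine (P' (E' `&` cellL a b)).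
  rewrite -F_cell; apply: fine_probability_le; [exact: measurableI..|].
  move=> w [Zw /andP[aL Lb']]; split => //; last by rewrite /cellL/= aL.
  apply/(E'Z _ (lt_trans a0 aL)); apply: (le_trans Zw).
  by have /andP[] := mono (L w) (introT andP (conj (ltW aL) Lb')).
(* The upper discrepancy splits as F(yh)(p - q) + (F(yh) - F(yl)) q + (h/2) p, and the lower one
   symmetrically. *)
have k1 : F yh * (p - q) <= h / 2.
  apply: le_trans pq; apply: (le_trans (ler_norm _)).
  by rewrite normrM ler_piMl// ger0_norm.
have k2 : F yl * (q - p) <= h / 2.
  rewrite distrC in pq; apply: le_trans pq; apply: (le_trans (ler_norm _)).
  by rewrite normrM ler_piMl// ger0_norm.
have k3 : (F yh - F yl) * q <= e * q by rewrite ler_wpM2r.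
have k4 : h / 2 * p <= h / 2 by rewrite ler_piMr// ltW.
rewrite -/q ler_norml; apply/andP.
move: up lo up' lo' k1 k2 k3 k4.
set A1 := fine (P (E t `&` _)); set A2 := fine (P' (E' `&` _)).
move: (F yh) (F yl) => fh fl.
by split; lra.
Unshelve. all: by end_near. Qed.

Let chain_close e r : 0 < r ->
  (forall a b, 0 < a -> a <= b -> b < a + r ->
    `|F (x * Num.sqrt b) - F (x * Num.sqrt a)| <= e) ->
  forall k a b, 0 < a -> a < b -> pmf L a = 0 -> pmf L b = 0 ->
  b - a <= k%:R * (r / 2) -> cell_close e a b.
Proof.
move=> r0 mesh; elim=> [|k IH] a b a0 ab La Lb.
  by rewrite mul0r subr_le0 leNgt ab.
rewrite -natr1 mulrDl mul1r => bak.
have [bar|arb] := ltP b (a + r).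
  by apply: local_close => //; exact: mesh (ltW ab) bar.
have r2 : a + r / 2 < a + r by lra.
(* Cutting before a + r keeps the first cell within the mesh; cutting after a + r/2 leaves a
   remainder of at most k half-meshes for the induction. *)
have [c /andP[c1 c2] Lc] := continuity_point_between _ _ _ P' L _ _ r2.
have ac : a < c by lra.
have cb : c < b by lra.
apply: (cell_close_trans _ _ _ _ (ltW ac) (ltW cb)).
  by apply: local_close => //; apply: mesh => //; exact: ltW.
by apply: IH => //; [exact: lt_trans ac|lra].
Qed.

(** The distribution function of [L] is 0 at 0 and right continuous there. *)
Let lower_tail e : 0 < e -> exists a, [/\ 0 < a, pmf L a = 0 &
  fine (P' [set w | L w <= a]) <= e].
Proof.
move=> e0.
have c0 : cdf L 0 = 0%E.
  have S0 : L @^-1` `]-oo, 0] = [set w | L w <= 0].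
    by apply/seteqP; split => w /=; rewrite in_itv.
  by rewrite /cdf /distribution /pushforward S0.
have := @cdf_right_continuous _ _ _ P' L 0; rewrite c0 => /fine_cvgP[_].
move=> /cvgrPdist_le/(_ _ e0) ce.
have /filter_ex[u [u0 Lu]] : \forall u \near (0 : R)^'+,
    0 < u /\ `|0 - fine (cdf L u)| <= e.
  by apply: filterI => //; exact: nbhs_right_gt.
have [a /andP[a0 au] La] := continuity_point_between _ _ _ P' L _ _ u0.
exists a; split => //; move: Lu; rewrite sub0r normrN ger0_norm ?fine_ge0//.
apply: le_trans; apply: fine_probability_le => //; [|exact: measurable_funPTI|].
  exact: measurable_le_fun.
by move=> w /=; rewrite in_itv/= => /le_trans; apply; exact: ltW.
Qed.

Let upper_tail e a : 0 < e -> exists b, [/\ a < b, pmf L b = 0 &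
  1 - fine (P' [set w | L w <= b]) <= e].
Proof.
move=> e0; have /fine_cvgP[_ /cvgrPdist_le/(_ _ e0) ce] := cvg_cdfy1 L.
have /filter_ex[u [au Lu]] : \forall u \near +oo,
    a < u /\ `|1 - fine (cdf L u)| <= e.
  by apply: filterI => //; exact: nbhs_pinfty_gt (num_real a).
have u1 : u < u + 1 by rewrite ltrDl.
have [b /andP[ub _] Lb] := continuity_point_between _ _ _ P' L _ _ u1.
exists b; split => //; first exact: lt_trans ub.
apply: le_trans (le_trans (ler_norm _) Lu); rewrite lerD2l lerN2.
apply: (fine_probability_le _ _ _ P');
  [exact: measurable_funPTI|exact: measurable_le_fun|].
by move=> w /=; rewrite in_itv/= => /le_trans; apply; exact: ltW.
Qed.

Theorem random_time_limit : fine (P (E t)) @[t --> +oo] --> fine (P' E').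
Proof.
(* The budget is 2h on the interval (a, b], 2h for the tails of [L], and 4h for those of N/t, each
   of which exceeds the matching tail of [L] by at most h. *)
apply/cvgrPdist_le => e e0; pose h := e / 8.
have h0 : 0 < h by rewrite divr_gt0.
have [a [a0 La La_e]] := lower_tail _ h0.
have [b [ab Lb Lb_e]] := upper_tail _ a h0.
have [r r0 mesh] := Fmesh _ h0.
have close : cell_close h a b.
  apply: (chain_close _ _ r0 mesh (Num.bound ((b - a) / (r / 2)))) => //.
  rewrite -ler_pdivrMr ?divr_gt0//; apply: ltW; apply: archi_boundP.
  by rewrite divr_ge0 ?divr_ge0 ?subr_ge0 ?(ltW ab)// ltW.
have /cvgrPdist_le/(_ _ h0) ca := cvgN _ La.
have /cvgrPdist_le/(_ _ h0) cb := cvgN _ Lb.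
near=> t.
have C : `|fine (P (E t `&` cellN t a b)) - fine (P' (E' `&` cellL a b))| <=
    h * fine (P' (cellL a b)) + h by near: t; exact: close.
have CA : `|fine (P' [set w | L w <= a]) - fine (P [set w | (N t w)%:R / t <= a])| <= h.
  by near: t.
have CB : `|fine (P' [set w | L w <= b]) - fine (P [set w | (N t w)%:R / t <= b])| <= h.
  by near: t.
have O := fine_probability_outside _ _ _ P (ratio t) (mratio t) (E t) a b (mE t) (ltW ab).
have O' := fine_probability_outside _ _ _ P' L mL E' a b mE' (ltW ab).
have hq : h * fine (P' (cellL a b)) <= h.
  by rewrite ler_piMr// ?(ltW h0)//; exact: q_le1.
have eh : e = 8 * h by rewrite /h; field.
move: C CA CB O O' hq La_e Lb_e; rewrite -/(cellN t a b) -/(cellL a b) eh.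
set c1 := fine (P (_ `&` _)); set c2 := fine (P' (_ `&` _)).
set c3 := fine (P' (cellL a b)); set c4 := fine (P' [set w | L w <= a]).
set c5 := fine (P [set w | _ <= a]); set c6 := fine (P' [set w | L w <= b]).
set c7 := fine (P [set w | _ <= b]); set c8 := fine (P (E t)); set c9 := fine (P' E').
rewrite !ler_norml => /andP[? ?] /andP[? ?] /andP[? ?] /andP[? ?] /andP[? ?] ? ? ?.
apply/andP; split; lra.
Unshelve. all: by end_near. Qed.

End random_time_limit.

Lemma cdf_preimage d (T : measurableType d) (R : realType) (P : probability T R)
  (X : {RV P >-> R}) x : cdf X x = P [set w | X w <= x].
Proof.
have S0 : X @^-1` `]-oo, x] = [set w | X w <= x].
  by apply/seteqP; split => w /=; rewrite in_itv.
by rewrite /cdf /distribution /pushforward S0.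
Qed.

Lemma cvg_cdfP d d' (T : measurableType d) (T' : measurableType d') (R : realType)
    (P : probability T R) (P' : probability T' R)
    (X : R -> {RV P >-> R}) (Y : {RV P' >-> R}) (x : R) :
  cdf (X t) x @[t --> +oo%R] --> cdf Y x <->
  fine (P [set w | X t w <= x]) @[t --> +oo] --> fine (P' [set w | Y w <= x]).
Proof.
have mX t : measurable [set w | X t w <= x].
  by apply: measurable_le_fun; exact: measurable_funPT.
have mY : measurable [set w | Y w <= x].
  by apply: measurable_le_fun; exact: measurable_funPT.
have -> : cdf Y x = (fine (P' [set w | Y w <= x]))%:E.
  by rewrite cdf_preimage fineK// fin_num_measure.
under eq_cvg do rewrite cdf_preimage.
split; first by move=> /fine_cvgP[].
by move=> h; apply/fine_cvgP; split => //; apply: nearW => t; rewrite fin_num_measure.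
Qed.

Lemma normal_cdf_mesh (R : realType) (v x e : R) : 0 <= v -> 0 < v \/ x != 0 -> 0 < e ->
  exists2 r : R, 0 < r & forall a b : R, 0 < a -> a <= b -> b < a + r ->
  `|normal_cdf R v (x * Num.sqrt b) - normal_cdf R v (x * Num.sqrt a)| <= e.
Proof.
move=> v0 vx e0; have [v1|v1] := ltP 0 v; last first.
  have vE : v = 0 by apply/eqP; rewrite eq_le v1.
  have xN0 : x != 0 by case: vx => //; rewrite vE ltxx.
  (* The arguments at a and b have the same sign, so both values agree whatever the radius. *)
  exists 1 => // a b a0 ab _; rewrite vE !normal_cdf0.
  rewrite !pmulr_lge0 ?sqrtr_gt0//; last exact: lt_le_trans ab.
  by rewrite subrr normr0 ltW.
pose s := Num.sqrt v.
have s0 : 0 < s by rewrite sqrtr_gt0.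
have -> : v = s ^+ 2 by rewrite sqr_sqrtr.
pose K := normal_peak s * (`|x| + 1).
have K0 : 0 < K by rewrite mulr_gt0 ?normal_peak_gt0 ?gt_eqF// ltr_wpDl.
(* From sqrt b - sqrt a <= sqrt (b - a) < e/K. The summand 1 in [K] keeps it positive when x = 0. *)
exists ((e / K) ^+ 2) => [|a b a0 ab bar]; first by rewrite exprn_gt0// divr_gt0.
rewrite !normal_cdfE//.
rewrite (le_trans (gaussian_cdf_lipschitz s s0 _ _))// -mulrBr normrM.
have ba0 : 0 <= b - a by rewrite subr_ge0.
have sab : `|Num.sqrt b - Num.sqrt a| <= e / K.
  rewrite ger0_norm ?subr_ge0 ?ler_wsqrtr//.
  apply: (@le_trans _ _ (Num.sqrt (b - a))).
    rewrite lerBlDl -(@ler_pXn2r _ 2) ?nnegrE ?addr_ge0 ?sqrtr_ge0//.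
    rewrite sqrrD !sqr_sqrtr//; [|exact: ltW|exact: le_trans (ltW a0) ab].
    have : 0 <= Num.sqrt a * Num.sqrt (b - a) by rewrite mulr_ge0 ?sqrtr_ge0.
    lra.
  rewrite -(@ger0_norm _ (e / K)) ?divr_ge0 ?(ltW e0) ?(ltW K0)// -sqrtr_sqr.
  by rewrite ler_wsqrtr// lerBlDl ltW.
have -> : e = K * (e / K) by field; rewrite gt_eqF.
rewrite mulrA ler_pM ?mulr_ge0 ?normal_peak_ge0//.
by rewrite ler_wpM2l ?normal_peak_ge0// lerDl.
Qed.

(* When the limiting variance is 0, this excludes [x = 0] from the points at which
   convergence has to be checked. *)
Lemma discontinuous_cdf_mul_dirac d (T : measurableType d) (R : realType)
    (P : probability T R) (Z I : {RV P >-> R}) :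
  has_normal_law P Z 0 0 -> ~ {for 0, continuous (cdf (Z \* I : {RV P >-> R}))}.
Proof.
move=> nZ.
have mA x : measurable [set w | (Z \* I : {RV P >-> R}) w <= x].
  by apply: measurable_le_fun; exact: measurable_funPT.
have Z0 : P (Z @^-1` [set 0]) = 1%E.
  have := nZ [set 0] (measurable_set1 0); rewrite /normal_law eqxx diracE.
  by rewrite mem_set.
have mZ0 : measurable (Z @^-1` [set 0]) by exact: measurable_funPTI.
have c0 : cdf (Z \* I : {RV P >-> R}) 0 = 1%E.
  rewrite cdf_preimage; apply/eqP; rewrite eq_le probability_le1//= -Z0.
  by rewrite le_measure ?inE// => w /= ->; rewrite mul0r.
have cN (y : R) : y < 0 -> cdf (Z \* I : {RV P >-> R}) y = 0%E.
  move=> y0; rewrite cdf_preimage; apply/eqP; rewrite eq_le measure_ge0 andbT.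
  have -> : 0%E = P (~` (Z @^-1` [set 0])).
    by rewrite probability_setC// Z0 subee.
  rewrite le_measure ?inE//; first exact: measurableC.
  by move=> w /= Zy Zw; move: Zy; rewrite Zw mul0r leNgt y0.
rewrite /prop_for/= /continuous_at c0 => /fine_cvgP[_ /cvgrPdist_lt/(_ _ ltr01)].
move=> /nbhs_ballP[r /= r0]; move=> /(_ (- (r / 2))).
have r20 : 0 < r / 2 by rewrite divr_gt0.
have b : ball 0 r (- (r / 2)).
  by rewrite /ball/= sub0r opprK gtr0_norm// ltr_pdivrMr// ltr_pMr// ltr1n.
by move=> /(_ b); rewrite /= cN ?oppr_lt0//= subr0 normr1 ltxx.
Qed.

Theorem theorem6 (R : realType)
    (d : measure_display) (T : measurableType d) (P : probability T R)
    (X : nat -> {RV P >-> R}) (N : R -> {RV P >-> nat})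
    (d' : measure_display) (T' : measurableType d') (P' : probability T' R)
    (Z L : {RV P' >-> R}) :
  let mu (k : nat) : R := fine (moment P (X 0%N) k) in
  let sigma2 : R :=
    mu 4%N / mu 1%N ^+ 4 - (mu 2%N / mu 1%N ^+ 2) ^+ 2
    + 4 * (mu 2%N / mu 1%N ^+ 2) ^+ 3 - 4 * mu 2%N * mu 3%N / mu 1%N ^+ 5 in
  mutually_independent P X ->
  identically_distributed P X ->
  (forall i, P [set w | 0 < X i w] = 1%E) ->
  counting_process P N ->
  independent_systems P (sigma_of_process [set: nat] X)
                        (sigma_of_process [set t : R | 0 <= t] N) ->
  (moment P (X 0%N) 4 < +oo)%E ->
  D_averages_in_time P P' N L ->
  has_normal_law P' Z 0 sigma2 ->
  independent_RVs P' Z L ->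
  cvg_in_distribution P P'
    (fun t => cst (Num.sqrt t) \*
      (real_of_count (N t) \* T_stat X (N t) \- cst (mu 2%N / mu 1%N ^+ 2)))
    (Z \* inv_sqrt L).
Proof.
move=> mu sigma2 indX idX Xpos cN indNX m4 [L1 cvgL] nZ indZL x.
have XE : moment P (X 0%N) 4 = (\int[P]_w (X 0%N w ^+ 4)%:E)%E.
  by rewrite /moment unlock.
have iX4 : P.-integrable setT (EFin \o (fun w => X 0%N w ^+ 4)).
  apply/integrableP; split; first by apply/measurable_EFinP; exact: measurable_funX.
  under eq_integral do rewrite /= ger0_norm ?exprn_even_ge0//.
  by rewrite -XE.
have muE k : mu k = \int[P]_w (X 0%N w ^+ k).
  by rewrite /mu /moment unlock.
have cvgV (y : R) : 0 < sigma2 \/ y != 0 ->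
    fine (P [set w | self_normalized _ _ _ P X n w <= y]) @[n --> \oo] -->
    normal_cdf R sigma2 y.
  by rewrite /sigma2 !muE; exact: cvg_self_normalized.
have v0 : 0 <= sigma2 by rewrite /sigma2 !muE; exact: sigma2_ge0.
move=> cx.
have vx : 0 < sigma2 \/ x != 0.
  have [v1|v1] := ltP 0 sigma2; first by left.
  right; apply/eqP => x0; rewrite {}x0 in cx.
  have vE : sigma2 = 0 by apply/eqP; rewrite eq_le v1.
  by rewrite vE in nZ; exact: (discontinuous_cdf_mul_dirac _ _ _ P' Z (inv_sqrt L) nZ cx).
apply/(cvg_cdfP _ _ _ _ _ P P').
have FE y : fine (P' [set w | Z w <= y]) = normal_cdf R sigma2 y.
  by rewrite -cdf_preimage /cdf nZ.
have L0 : P' [set w | L w <= 0] = 0%E.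
  rewrite (_ : [set _ | _] = ~` [set w | 0 < L w]).
    rewrite probability_setC ?L1 ?subee//.
    rewrite (_ : [set _ | _] = ~` [set w | L w <= 0]).
      by apply: measurableC; apply: measurable_le_fun; exact: measurable_funPT.
    by apply/seteqP; split => w /=; rewrite ltNge => /negP.
  by apply/seteqP; split => w /=; rewrite leNgt => /negP.
apply: (random_time_limit _ _ _ _ _ P P' N (self_normalized _ _ _ P X) _ Z L _ x).
- exact: measurable_self_normalized.
- by move=> t; apply: measurable_le_fun; exact: measurable_funPT.
- by apply: measurable_le_fun; exact: measurable_funPT.
(* The event on V_n must be shown to lie in the sigma-algebra of the X_i, hence the X_i regarded as
   functions on that smaller measurable space. *)
- move=> t n y t0; rewrite setIC muleC; apply: indNX.
    have mX i : measurable_fun setT (X i : g_sigma_algebraType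
        (\bigcup_(i in [set: nat]) preimage_set_system setT (X i) measurable) -> R).
      move=> _ B mB; rewrite setTI; apply: sub_sigma_algebra; exists i => //.
      by exists B => //; rewrite setTI.
    have mS := measurable_self_normalized_sum _ _ _ _ n (\int[P]_w (X 0%N w ^+ 2) /
      (\int[P]_w (X 0%N w ^+ 1)) ^+ 2) mX.
    exact: (measurable_le_fun _ _ _ _ mS y).
  apply: sub_sigma_algebra; exists t => //; exists [set n] => //.
  by rewrite setTI.
- move=> y B mB; apply: indZL; last by exists B => //; rewrite setTI.
  exists `]-oo, y]%classic => //; rewrite setTI.
  by apply/seteqP; split => w /=; rewrite in_itv.
- move=> t w t0 N0; rewrite /= /self_normalized /T_stat N0 !muE /real_of_count.
  set u := (_ * _ - _).
  (* Both sides of sqrt t * u <= x get multiplied by sqrt N / sqrt t, which is positive since N >=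
     1. *)
  rewrite sqrtrM// sqrtrV ?(ltW t0)//.
  have st : 0 < Num.sqrt t by rewrite sqrtr_gt0.
  have sN : 0 < Num.sqrt (N t w)%:R :> R by rewrite sqrtr_gt0 ltr0n.
  rewrite mulrCA ler_pM2l// ler_pdivlMr// mulrC.
  by split.
- move=> w Lw; rewrite /= /inv_sqrt ler_pdivrMr ?sqrtr_gt0//.
- move=> s s0; rewrite FE; apply: cvgV.
  case: vx => [|x0]; [by left|right].
  by rewrite mulf_neq0// gt_eqF// sqrtr_gt0.
- move=> s Ls; have cL := continuous_cdf _ _ _ P' L s Ls.
  exact: ((cvg_cdfP _ _ _ _ _ P P'
    (fun t => real_of_count (N t) \* cst t^-1 : {RV P >-> R}) L s).1 (cvgL s cL)).
- move=> e e0; have [r r0 H] := normal_cdf_mesh R sigma2 x e v0 vx e0.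
  by exists r => // a b a0 ab bar; rewrite !FE; exact: H.
- exact: L0.
Qed.
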